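(* For every integer $\ell \geq 3$, every $W_\ell$-induced-minor-free graph $G$, and every weighting $\mathsf{w}$ of $G$, there is a $\mathsf{w}$-balanced separator $S$ of $G$ that either is dominated by at most $\ell$ vertices (i.e. $S \subseteq N[D]$ for some $D \subseteq V(G)$ with $|D| \leq \ell$) or has size at most $(\ell-1)^2$.
   Context: All graphs are finite and simple. $W_\ell$ is the graph obtained from a cycle of length $\ell$ by adding a vertex adjacent to all vertices of the cycle. A graph $H$ is an induced minor of $G$ if $H$ is isomorphic to a graph obtained from $G$ by deleting vertices and contracting edges; $G$ is $H$-induced-minor-free if $H$ is not an induced minor of $G$. A weighting of $G$ is a function $\mathsf{w}\colon V(G) \to \mathbb{R}_{\geq 0}$; $\mathsf{w}(A)=\sum_{v\in A}\mathsf{w}(v)$. A subgraph $H$ is heavy if $\mathsf{w}(H) > \frac12\mathsf{w}(V(G))$. A set $S \subseteq V(G)$ is a $\mathsf{w}$-balanced separator if no component of $G-S$ is heavy. $N[D]$ is the closed neighbourhood of $D$. *)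

(* Defs.v *)
From mathcomp Require Import all_boot all_order all_algebra.
From mathcomp Require Import reals.
Set Implicit Arguments.
Unset Strict Implicit.
Unset Printing Implicit Defensive.
Import Order.TTheory GRing.Theory Num.Theory.

Record sgraph := SGraph {
  vertex :> finType;
  edge : rel vertex;
  edge_sym : symmetric edge;
  edge_irrefl : irreflexive edge
}.

Arguments edge {s}.

Definition isomorphic (G H : sgraph) : Prop :=
  exists f : G -> H, bijective f /\ forall x y, edge (f x) (f y) = edge x y.

Section Induced.
Variables (G : sgraph) (A : {set G}).

Definition induced_edge : rel {x : G | x \in A} :=
  [rel u v | edge (val u) (val v)].

Lemma induced_edge_sym : symmetric induced_edge.
Proof. by move=> u v; apply: edge_sym. Qed.

Lemma induced_edge_irrefl : irreflexive induced_edge.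
Proof. by move=> u; apply: edge_irrefl. Qed.

Definition induced : sgraph := SGraph induced_edge_sym induced_edge_irrefl.
End Induced.

Definition delete_vertices (G : sgraph) (S : {set G}) : sgraph := induced (~: S).

(* The vertex y is merged into x, and x stands for the merged vertex; loops and
   parallel edges disappear.  This is the contraction of the edge xy when
   [edge x y] holds. *)
Section Contract.
Variables (G : sgraph) (x y : G).

Definition contract_edge : rel {z : G | z \in [set~ y]} :=
  [rel u v | (u != v) &&
     [|| edge (val u) (val v),
         (val u == x) && edge y (val v)
       | (val v == x) && edge (val u) y]].

Lemma contract_edge_sym : symmetric contract_edge.
Proof.
move=> u v; rewrite /contract_edge /= eq_sym [edge (val v) _]edge_sym.
by rewrite [edge y (val v)]edge_sym [edge y (val u)]edge_sym (orbC (_ && edge _ y)).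
Qed.

Lemma contract_edge_irrefl : irreflexive contract_edge.
Proof. by move=> u; rewrite /contract_edge /= eqxx. Qed.

Definition contract : sgraph := SGraph contract_edge_sym contract_edge_irrefl.
End Contract.

(* [induced_minor H G]: H is an induced minor of G. *)
Inductive induced_minor (H : sgraph) : sgraph -> Prop :=
| induced_minor_iso (G : sgraph) :
    isomorphic G H -> induced_minor H G
| induced_minor_delete (G : sgraph) (v : G) :
    induced_minor H (delete_vertices [set v]) -> induced_minor H G
| induced_minor_contract (G : sgraph) (x y : G) :
    edge x y -> induced_minor H (contract x y) -> induced_minor H G.

Definition induced_minor_free (H G : sgraph) : Prop := ~ induced_minor H G.

(* [ordS i] is i + 1 modulo l; the test [i != j] only matters for l = 1.
   This is the cycle of length l when l >= 3. *)
Section Cycle.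
Variable l : nat.

Definition cycle_edge : rel 'I_l :=
  [rel i j | (i != j) && ((j == ordS i) || (i == ordS j))].

Lemma cycle_edge_sym : symmetric cycle_edge.
Proof. by move=> i j; rewrite /cycle_edge /= eq_sym orbC. Qed.

Lemma cycle_edge_irrefl : irreflexive cycle_edge.
Proof. by move=> i; rewrite /cycle_edge /= eqxx. Qed.

Definition cycle_graph : sgraph := SGraph cycle_edge_sym cycle_edge_irrefl.
End Cycle.

(* [None] is the added vertex, adjacent to all vertices of G. *)
Section AddUniversal.
Variable G : sgraph.

Definition cone_edge : rel (option G) :=
  fun u v => match u, v with
             | Some x, Some y => edge x y
             | None, None => false
             | _, _ => true
             end.

Lemma cone_edge_sym : symmetric cone_edge.
Proof. by move=> [x|] [y|] //=; apply: edge_sym. Qed.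

Lemma cone_edge_irrefl : irreflexive cone_edge.
Proof. by move=> [x|] //=; apply: edge_irrefl. Qed.

Definition cone : sgraph := SGraph cone_edge_sym cone_edge_irrefl.
End AddUniversal.

Definition wheel (l : nat) : sgraph := cone (cycle_graph l).

Definition components (G : sgraph) : {set {set G}} :=
  equivalence_partition (connect edge) [set: G].

Definition closed_nbhd (G : sgraph) (D : {set G}) : {set G} :=
  [set x | [exists d in D, (x == d) || edge d x]].

Section Weights.
Local Open Scope ring_scope.
Variables (R : realType) (G : sgraph) (w : G -> R).

Definition weighting : Prop := forall x, 0 <= w x.

Definition weight (A : {set G}) : R := \sum_(x in A) w x.

(* A subgraph enters only through its vertex set A. *)
Definition heavy (A : {set G}) : Prop := 2^-1 * weight [set: G] < weight A.

(* The components of G - S are sets of vertices of the subtype of vertices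
   outside S; their images under [sval] are sets of vertices of G. *)
Definition balanced_separator (S : {set G}) : Prop :=
  forall C : {set delete_vertices S},
    C \in components (delete_vertices S) -> ~ heavy [set sval x | x in C].
End Weights.

(* Main.v *)
Require Import Defs.
From mathcomp Require Import all_boot all_order all_algebra.
From mathcomp Require Import boolp reals zify.

(** Call a set S small if it has at most (l-1)^2 vertices or lies in N[D] with
|D| <= l, and suppose that G - S has a heavy component B(S) for every small S.
Two heavy sets always meet.

A shortest induced path P such that N[P] is balanced has more than l vertices.
Removing either end of P leaves a heavy component, and the union of the two
components closes P into an induced cycle Z.  A wheel-free graph has at most
l-1 attachments of a connected set outside an induced cycle on that cycle;
hence Z is balanced: a heavy component K of G - Z would contain B(N[N(K)]),
which avoids N[P].

Let X be a component of G - Z.  Its attachments cut Z into at most l-1 gaps;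
every gap, closed by a path through X, is an induced cycle Z', and the component
H' of G - Z' containing the rest of Z has at most l-1 attachments D'.  The union
of the sets D' has at most (l-1)^2 vertices, and as Z is balanced some gap has
B(D') disjoint from H'; then Z' is again balanced.

Now choose a balanced cycle and either two vertices a, b on it or a component H
of its complement, so that Y = B({a, b}), lying on one side of a and b, or
Y = B(N(H)) is smallest.  The gap argument applied to H shows that the first
kind is always attained.  By minimality of Y, every vertex z of the cycle in Y is
jumped over by a component of the complement inside Y.  Among the balanced cycles
through a, b and the same outer arc, and the components H inside Y attached to a
and to some z in Y, choose one with the fewest vertices between z and b.
Rerouting the cycle through a component that jumps over z gives either a smaller
Y or a shorter tail. *)

Set Implicit Arguments.
Unset Strict Implicit.
Unset Printing Implicit Defensive.
Import Order.TTheory GRing.Theory Num.Theory.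

(** * Connected sets and induced minor models *)

Section Connectivity.
Variable G : sgraph.
Implicit Types (A B T : {set G}) (x y : G).

(* Quantifying over closed predicates gives induction along the edges of A. *)
Definition conn A :=
  forall P : G -> Prop, (exists2 x, x \in A & P x) ->
    (forall x y, x \in A -> y \in A -> edge x y -> P x -> P y) ->
  forall x, x \in A -> P x.

Definition nbh A : {set G} :=
  [set y | (y \notin A) && [exists x in A, edge x y]].

Lemma nbhP A y :
  reflect (y \notin A /\ exists2 x, x \in A & edge x y) (y \in nbh A).
Proof.
rewrite inE; apply: (iffP andP) => -[yA].
  by case/exists_inP=> x xA xy; split=> //; exists x.
by case=> x xA xy; split=> //; apply/exists_inP; exists x.
Qed.

Lemma nbh_notin A x : x \in nbh A -> x \notin A.
Proof. by case/nbhP. Qed.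

Lemma nbhI A x y : x \in A -> edge x y -> y \notin A -> y \in nbh A.
Proof. by move=> xA xy yA; apply/nbhP; split=> //; exists x. Qed.

(** Membership in [B] spreads along the edges inside [A], because the first step out of [B] would
    land in [nbh B]. Most containments between components below come from this. *)
Lemma conn_sub A B :
  conn A -> (exists2 x, x \in A & x \in B) ->
  (forall x, x \in A -> x \notin nbh B) -> A \subset B.
Proof.
move=> cA AB AN; apply/subsetP/(cA _ AB) => x y xA yA xy xB.
by apply: contraT => yB; move: (AN y yA); rewrite (nbhI xB xy yB).
Qed.

Lemma connU A B :
  conn A -> conn B -> (exists2 x, x \in A & x \in B) -> conn (A :|: B).
Proof.
move=> cA cB [z zA zB] P [x0 x0AB Px0] Pcl.
have PA x : x \in A -> P x -> forall y, y \in A -> P y.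
  move=> xA Px; apply: cA; first by exists x.
  by move=> u v uA vA; apply: Pcl; rewrite inE ?uA ?vA.
have PB x : x \in B -> P x -> forall y, y \in B -> P y.
  move=> xB Px; apply: cB; first by exists x.
  by move=> u v uB vB; apply: Pcl; rewrite inE ?uB ?vB orbT.
have Pz : P z by case/setUP: x0AB => [/PA|/PB]; apply.
by move=> x /setUP[/(PA z zA Pz)|/(PB z zB Pz)].
Qed.

Lemma conn1 x : conn [set x].
Proof. by move=> P [y /set1P-> Px] _ z /set1P->. Qed.

Lemma conn_nbh_add A x : conn A -> x \in nbh A -> conn (x |: A).
Proof.
move=> cA /nbhP[xA [y yA yx]] P [z zx Pz] Pcl.
have xX : x \in x |: A by rewrite !inE eqxx.
have AX u : u \in A -> u \in x |: A by move=> uA; rewrite !inE uA orbT.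
have PA u : u \in A -> P u -> forall v, v \in A -> P v.
  move=> uA Pu; apply: cA; first by exists u.
  by move=> v w vA wA; apply: Pcl; apply: AX.
have Py : P y.
  case/setU1P: zx Pz => [->|zA Pz]; last exact: (PA z).
  by apply: Pcl => //; [apply: AX | rewrite edge_sym].
move=> v /setU1P[->|vA]; first by apply: Pcl yx Py => //; apply: AX.
exact: (PA y).
Qed.

(** [B] is the component of the graph minus [T] that contains [A], obtained as a class of
    reachability outside [T]. *)
Lemma conn_extend T A :
  conn A -> (exists x, x \in A) -> (forall x, x \in A -> x \notin T) ->
  exists B, [/\ conn B, A \subset B, forall x, x \in B -> x \notin T
             & nbh B \subset T].
Proof.
move=> cA [x0 x0A] AT.
pose e := [rel x y : G | [&& x \notin T, y \notin T & edge x y]].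
have sym_e : connect_sym e.
  by apply: sym_connect_sym => x y; rewrite /= edge_sym andbCA.
pose B := [set y | connect e x0 y].
have BT x : x \in B -> x \notin T.
  rewrite inE => /connectP[p]; elim/last_ind: p => [_ ->|p y _]; first exact: AT.
  by rewrite rcons_path last_rcons => /andP[_ /and3P[_ yT _]] ->.
have Bcl x y : x \in B -> y \notin T -> edge x y -> y \in B.
  move=> xB yT xy; have xT := BT x xB; move: xB; rewrite !inE => x0x.
  by apply: connect_trans x0x _; apply: connect1; rewrite /= xT yT.
exists B; split; last 1 first.
- apply/subsetP=> y /nbhP[yB [x xB xy]]; apply: contraT => yT.
  by rewrite (Bcl x) in yB.
- move=> P [x xB Px] Pcl y yB.
  have: connect e x y.
    by move: xB yB; rewrite !inE sym_e => /connect_trans/[apply].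
  case/connectP=> p; elim: p x xB Px => [|z p IH] x xB Px /=; first by move=> _ ->.
  case/andP=> /and3P[_ zT xz]; have zB := Bcl _ _ xB zT xz.
  by apply: IH => //; apply: Pcl xz Px.
- apply/subsetP; apply: cA; first by exists x0; rewrite ?inE.
  by move=> x y _ yA xy xB; apply: Bcl xy => //; apply: AT.
- exact: BT.
Qed.

End Connectivity.

Section MinorModel.
Variable H : sgraph.

(** [f] names the branch set of each vertex, and [None] marks a deleted vertex. The equivalence in
    the last clause, instead of one implication, makes the minor induced. *)
Definition minor_model (G : sgraph) (f : G -> option H) :=
  [/\ forall h, exists x, f x = Some h,
      forall h, conn [set x | f x == Some h] &
      forall h h', h != h' ->
        edge h h' <-> exists x y, [/\ f x = Some h, f y = Some h' & edge x y]].

Lemma model_delete (G : sgraph) (f : G -> option H) (v : G) :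
  minor_model f -> f v = None ->
  minor_model (fun u : delete_vertices [set v] => f (val u)).
Proof.
case=> [fsurj fconn fedge] fv.
have sub x h : f x = Some h -> exists u : delete_vertices [set v], val u = x.
  move=> fx; have xv : x \in ~: [set v].
    by rewrite !inE; apply: contraPneq fx => ->; rewrite fv.
  by exists (Sub x xv).
split.
- by move=> h; have [x fx] := fsurj h; have [u ux] := sub _ _ fx; exists u; rewrite ux.
- move=> h P [u0 u0h Pu0] Pcl u uh.
  apply: (fconn h (fun x => forall u : delete_vertices [set v], val u = x -> P u)
    _ _ (val u) _ u (erefl _)); last by move: uh; rewrite !inE.
    exists (val u0); first by move: u0h; rewrite !inE.
    by move=> t /val_inj->.
  move=> x y; rewrite !inE => /eqP fx /eqP fy xy Px t ty.
  have [u' ux'] := sub _ _ fx.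
  apply: (Pcl u' t _ _ _ (Px u' ux')); rewrite ?inE ?ux' ?ty ?fx ?fy //.
  by have := xy; rewrite -ux' -ty.
- move=> h h' hh'; split=> [/(fedge _ _ hh')[x [y [fx fy xy]]]|[u [u' [fu fu' uu']]]].
    have [u ux] := sub _ _ fx; have [u' uy] := sub _ _ fy.
    by exists u, u'; split; rewrite ?ux ?uy //; have := xy; rewrite -ux -uy.
  by apply/(fedge _ _ hh'); exists (val u), (val u').
Qed.

Lemma model_contract (G : sgraph) (f : G -> option H) (x z : G) :
  minor_model f -> edge x z -> f x = f z ->
  minor_model (fun u : contract x z => f (val u)).
Proof.
case=> [fsurj fconn fedge] xz fxz.
have xNz : x != z by apply: contraTneq xz => ->; rewrite edge_irrefl.
(* [r] is the contraction map: it sends an edge to an edge or collapses it to a vertex. *)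
pose r t := if t == z then x else t.
have fr t : f (r t) = f t by rewrite /r; case: eqP => // ->.
have sub t : exists u : contract x z, val u = r t.
  have rt : r t \in [set~ z] by rewrite !inE /r; case: (eqVneq t z).
  by exists (Sub (r t) rt).
have rE (u : contract x z) : r (val u) = val u.
  by rewrite /r; case: eqP (valP u) => // ->; rewrite !inE eqxx.
have redge t t' (u u' : contract x z) :
    val u = r t -> val u' = r t' -> edge t t' -> u = u' \/ edge u u'.
  move=> ut ut' tt'; case: (eqVneq u u') => [|uu']; [by left | right].
  change ((u != u') && [|| edge (val u) (val u'),
    (val u == x) && edge z (val u') | (val u' == x) && edge (val u) z]).
  rewrite uu' /= ut ut' /r.
  case: (eqVneq t z) tt' => [->|tz]; case: (eqVneq t' z) => [->|t'z] tt' //=.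
  - by rewrite edge_irrefl in tt'.
  - by rewrite eqxx tt' orbT.
  - by rewrite eqxx tt' !orbT.
  - by rewrite tt'.
split.
- by move=> h; have [t ft] := fsurj h; have [u ut] := sub t; exists u; rewrite ut fr.
- move=> h P [u0 u0h Pu0] Pcl u uh.
  apply: (fconn h (fun t => forall u : contract x z, val u = r t -> P u)
    _ _ (val u) _ u _); last by rewrite rE.
  - exists (val u0); first by move: u0h; rewrite !inE.
    by move=> t; rewrite rE => /val_inj->.
  - move=> t t'; rewrite !inE => ft ft' tt' Pt u' ut'.
    have [v vt] := sub t; have [<-|vu'] := redge _ _ _ _ vt ut' tt'; first exact: Pt.
    by apply: Pcl vu' (Pt v vt); rewrite inE ?vt ?ut' fr.
  - by move: uh; rewrite !inE.
- move=> h h' hh'; split=> [/(fedge _ _ hh')[t [t' [ft ft' tt']]]|].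
    have [u ut] := sub t; have [u' ut'] := sub t'.
    exists u, u'; rewrite ut ut' !fr; split=> //.
    have [uu'|//] := redge _ _ _ _ ut ut' tt'.
    by move: hh'; rewrite -(inj_eq Some_inj) -ft -ft' -(fr t) -(fr t') -ut -ut' uu' eqxx.
  case=> u [u' [fu fu' /= /andP[_ /or3P[uu'|/andP[/eqP ux zu']|/andP[/eqP ux uz]]]]].
  - by apply/(fedge _ _ hh'); exists (val u), (val u').
  - by apply/(fedge _ _ hh'); exists z, (val u'); rewrite -fxz -ux.
  - by apply/(fedge _ _ hh'); exists (val u), z; rewrite -fxz -ux.
Qed.

(** Induction on the number of vertices: delete a vertex outside all branch sets, or contract an
    edge inside one. When neither is possible, the branch sets are singletons and [f] is an
    isomorphism. *)
Lemma model_induced_minor (G : sgraph) (f : G -> option H) :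
  minor_model f -> induced_minor H G.
Proof.
have [n] := ubnP #|G|; elim: n G f => // n IH G f cG mf.
case: (boolP [exists v, f v == None]) => [/existsP[v /eqP fv]|].
  apply: (@induced_minor_delete _ _ v); apply: IH (model_delete mf fv).
  rewrite card_sig; apply: leq_trans (cG : #|G| <= n).
  apply: (@leq_ltn_trans #|[set~ v]|); first by apply/eq_leq/eq_card=> x; rewrite !inE.
  by rewrite cardsC1 ltn_predL; apply/card_gt0P; exists v.
rewrite negb_exists => /forallP fsome.
case: (boolP [exists x, [exists z, edge x z && (f x == f z)]]) => [|].
  case/existsP=> x /existsP[z /andP[xz /eqP fxz]].
  apply: (@induced_minor_contract _ _ x z) => //.
  apply: IH (model_contract mf xz fxz).
  rewrite card_sig; apply: leq_trans (cG : #|G| <= n).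
  apply: (@leq_ltn_trans #|[set~ z]|); first by apply/eq_leq/eq_card=> y; rewrite !inE.
  by rewrite cardsC1 ltn_predL; apply/card_gt0P; exists z.
rewrite negb_exists => /forallP fne.
have [fsurj fconn fedge] := mf.
(* In a connected branch set without inner edges, nothing but [x] can be reached from [x]. *)
have finj x y : f x = f y -> x = y.
  case fx: (f x) (fsome x) => [h|//] _ fy.
  apply: (fconn h (fun z => x = z)); last by rewrite inE -fy.
    by exists x; rewrite // inE fx.
  move=> u v; rewrite !inE => _ fv uv xu; move: (fne x); rewrite negb_exists.
  by move/forallP/(_ v); rewrite {1}xu uv fx eq_sym fv.
have [g fg] : exists g : G -> H, forall x, f x = Some (g x).
  have : forall x, exists h, f x = Some h.
    by move=> x; case: (f x) (fsome x) => // h; exists h.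
  by case/choice=> g gP; exists g.
have [k fk] := choice fsurj.
apply: induced_minor_iso; exists g; split.
  exists k => [x|h]; last by apply: Some_inj; rewrite -fg fk.
  by apply: finj; rewrite fk fg.
move=> x y; case: (eqVneq x y) => [->|xy]; first by rewrite !edge_irrefl.
have gxy : g x != g y.
  by apply: contraNneq xy => gxy; apply/eqP/finj; rewrite !fg gxy.
apply/idP/idP => [/(fedge _ _ gxy)[u [v [fu fv uv]]]|exy].
  have -> : x = u by apply: finj; rewrite fg fu.
  by have -> : y = v by apply: finj; rewrite fg fv.
by apply/(fedge _ _ gxy); exists x, y; rewrite !fg.
Qed.

End MinorModel.

(** * Induced paths and cycles *)

Lemma split_last (T : Type) (a : pred T) (s : seq T) : has a s ->
  exists s1 z s2, [/\ s = s1 ++ z :: s2, a z & ~~ has a s2].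
Proof.
elim: s => [|x s IH] //=; case: (boolP (has a s)) => [/IH|Nas].
  by case=> s1 [z [s2 [-> az Na]]] _; exists (x :: s1), z, s2.
by rewrite orbF => ax; exists [::], x, s.
Qed.

Section Cycles.
Variable G : sgraph.
Implicit Types (p q s t : seq G) (x y z u v : G) (X : {set G}).

Definition padj (i j : nat) := (j == i.+1) || (i == j.+1).

(* Adjacency of positions i, j < n on a cycle of length n >= 3. *)
Definition cadj (n i j : nat) :=
  [|| padj i j, (i == 0) && (j.+1 == n) | (j == 0) && (i.+1 == n)].

(** Equating adjacency with a test on positions gives the edges of the path and forbids chords at
    once. *)
Definition ipath p :=
  uniq p /\ {in p &, forall u v, edge u v = padj (index u p) (index v p)}.

Definition icyc s :=
  [/\ uniq s, 3 <= size s &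
      {in s &, forall u v, edge u v = cadj (size s) (index u s) (index v s)}].

Lemma icyc_rot p q : icyc (p ++ q) -> icyc (q ++ p).
Proof.
case=> U S E; split; first by rewrite uniq_catC.
  by rewrite size_cat addnC -size_cat.
move=> u v; rewrite !mem_cat => uqp vqp.
rewrite E ?mem_cat 1?orbC // !size_cat !index_cat.
move: U; rewrite cat_uniq => /and3P[_ /hasPn pq _].
have up : u \in q -> u \in p = false by move/pq/negbTE.
have vp : v \in q -> v \in p = false by move/pq/negbTE.
have := index_mem u p; have := index_mem u q.
have := index_mem v p; have := index_mem v q.
move: uqp vqp up vp; rewrite /cadj /padj.
case: (u \in q) => /=; [move=> _|move=> ->];
  case: (v \in q) => /=; [move=> _|move=> ->|move=> _|move=> ->].
- by move=> -> // -> //; lia.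
- by move=> -> // _; lia.
- by move=> _ -> //; lia.
- by move=> _ _; lia.
Qed.

Lemma ipath_catl p q : ipath (p ++ q) -> ipath p.
Proof.
case; rewrite cat_uniq => /andP[U _] E; split=> // u v up vp.
by rewrite E ?mem_cat ?up ?vp // !index_cat up vp.
Qed.

Lemma ipath_catr p q : ipath (p ++ q) -> ipath q.
Proof.
case; rewrite cat_uniq => /and3P[_ /hasPn pq U] E; split=> // u v uq vq.
rewrite E ?mem_cat ?uq ?vq ?orbT // !index_cat (negbTE (pq _ uq)) (negbTE (pq _ vq)).
by rewrite /padj -!addnS !eqn_add2l.
Qed.

Lemma icyc_ipath p q : icyc (p ++ q) -> q != [::] -> ipath p.
Proof.
case; rewrite cat_uniq => /andP[U _] _ E q0; split=> // u v up vp.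
rewrite E ?mem_cat ?up ?vp // !index_cat up vp size_cat /cadj.
have : 0 < size q by case: (q) q0.
have : index u p < size p by rewrite index_mem.
have : index v p < size p by rewrite index_mem.
rewrite /padj; lia.
Qed.

Lemma ipath_cons u v p : ipath (v :: p) -> u \notin v :: p -> edge u v ->
  (forall w, w \in p -> ~~ edge u w) -> ipath (u :: v :: p).
Proof.
move=> [U E] uNvp uv uNp; split; first by rewrite cons_uniq uNvp.
have uE w : w \in v :: p -> edge u w = padj 0 (index w (v :: p)).+1.
  rewrite inE => /predU1P[->|wp]; first by rewrite uv /padj /= eqxx.
  have vw : (v == w) = false.
    by apply: contraTF U => /eqP->; rewrite cons_uniq wp.
  by rewrite (negbTE (uNp w wp)) /padj /= vw.
have uN w : w \in v :: p -> (u == w) = false.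
  by move=> wp; apply: contraNF uNvp => /eqP->.
move=> a b; rewrite (in_cons u _ a) (in_cons u _ b).
move=> /predU1P[->|ap] /predU1P[->|bp].
- by rewrite edge_irrefl /= eqxx.
- by rewrite uE //= eqxx uN.
- by rewrite edge_sym uE //= eqxx uN // /padj orbC.
- by rewrite E //= !uN // /padj !eqSS.
Qed.

(** The start moves along the edges of [A], beginning at [v]. A new start already on the path cuts
    it there; otherwise it is joined to its last neighbour on the path, so that no chord arises. *)
Lemma ipath_exists (A : {set G}) u v : conn A -> u \in A -> v \in A ->
  exists p, [/\ ipath (u :: p), last u p = v & {subset u :: p <= A}].
Proof.
move=> cA uA vA; move: u uA; apply: cA.
  exists v => //; exists [::]; split=> //; last by move=> x; rewrite inE => /eqP->.
  by split=> // x y; rewrite !inE => /eqP-> /eqP->; rewrite edge_irrefl /= eqxx.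
move=> w w' wA w'A ww' [p [ip lp pA]].
case: (boolP (w' \in w :: p)) => [/splitPr|w'p].
  case E: (w :: p) / => [p1 p2].
  exists p2; split; first by move: ip; rewrite E => /ipath_catr.
    by have := congr1 (last w) E; rewrite /= lp last_cat /= => ->.
  by move=> x xp; apply: pA; rewrite E mem_cat xp orbT.
have /split_last[s1 [z [s2 [E w'z Ns2]]]] : has (edge w') (w :: p).
  by rewrite /= edge_sym ww'.
exists (z :: s2); split.
- apply: ipath_cons w'z _ => //; first by move: ip; rewrite E => /ipath_catr.
    by apply: contra w'p; rewrite E mem_cat orbC => ->.
  by move=> x xs2; apply: contra Ns2 => ?; apply/hasP; exists x.
- by have := congr1 (last w) E; rewrite /= lp last_cat /= => ->.
- move=> x; rewrite in_cons => /predU1P[->//|xs]; apply: pA.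
  by rewrite E mem_cat xs orbT.
Qed.

(** An induced path from [y] back to [x] through [X] closes the given one. No chord joins the two,
    since on the given path only [x] and [y] have neighbours in [X]. *)
Lemma close_path x g y X :
  ipath (x :: rcons g y) -> g != [::] -> conn X ->
  (forall u, u \in x :: rcons g y -> u \notin X) ->
  x \in nbh X -> y \in nbh X -> (forall u, u \in g -> u \notin nbh X) ->
  exists t, [/\ t != [::], {subset t <= X} & icyc (x :: rcons g y ++ t)].
Proof.
set p := x :: rcons g y => ip g0 cX pX xX yX gX.
have sp : size p = (size g).+2 by rewrite /= size_rcons.
have xp : x \in p by rewrite inE eqxx.
have yp : y \in p by rewrite inE mem_rcons inE eqxx orbT.
have ix : index x p = 0 by rewrite /= eqxx.
have U : uniq p by case: ip.
have iy : index y p = (size g).+1.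
  move: (U); rewrite /= rcons_uniq mem_rcons inE => /and3P[/norP[/negbTE xy _] yg _].
  by rewrite xy -cats1 index_cat (negbTE yg) /= eqxx addn0.
have sg : 0 < size g by case: (g) g0.
have gi u : u \in p -> u != x -> u != y -> u \in g.
  by rewrite inE mem_rcons inE => /or3P[->|->|].
have cA : conn (y |: (x |: X)).
  apply: conn_nbh_add; first exact: conn_nbh_add.
  have [yX' [z zX zy]] := nbhP _ _ yX; apply: nbhI zy _; first by rewrite !inE zX orbT.
  rewrite !inE negb_or yX' andbT; apply: contraTneq U => yx.
  by rewrite /p yx /= mem_rcons inE eqxx.
have [||q [iq lq qA]] := ipath_exists (u := y) (v := x) cA; rewrite ?inE ?eqxx ?orbT //.
have {iq lq qA} [t [E it tA]] : exists t, [/\ q = rcons t x, ipath (y :: rcons t x)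
    & {subset t <= y |: (x |: X)}].
  case/lastP: q iq lq qA => [|t z] iq.
    by move=> /= yx; move: U; rewrite /p yx /= mem_rcons inE eqxx.
  rewrite last_rcons => zx qA; rewrite zx in iq qA; exists t; split; rewrite ?zx //.
  by move=> u ut; apply: qA; rewrite inE mem_rcons inE ut !orbT.
case: it => Ut Et.
(* As [g] is nonempty, [x] and [y] are not consecutive on an induced path, hence not adjacent. *)
have t0 : t != [::].
  apply/eqP=> t0; move: Et; rewrite t0 => /(_ y x).
  rewrite !inE !eqxx orbT => /(_ isT isT) /=.
  have [_ Ep] := ip; rewrite Ep // ix iy eqxx.
  by move: Ut; rewrite t0 /= andbT inE => /negbTE->; rewrite eqxx /padj; lia.
have st : 0 < size t by case: (t) t0.
have tX u : u \in t -> u \in X.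
  move=> ut; move: (tA u ut) (Ut); rewrite !inE => /or3P[/eqP uy|/eqP ux|//].
    by rewrite -uy cons_uniq mem_rcons inE ut orbT.
  by rewrite -ux cons_uniq rcons_uniq ut andbF.
have tp u : u \in t -> u \in p = false.
  by move=> /tX uX; apply/negP=> /pX; rewrite uX.
exists t; split=> //.
have Eyt u : u \in t -> index u (y :: rcons t x) = (index u t).+1.
  move=> ut; have /negbTE uy : y != u by apply: contraFneq (tp u ut) => <-.
  by rewrite /= uy -cats1 index_cat ut.
have Ex : index x (y :: rcons t x) = (size t).+1.
  move: (Ut); rewrite /= mem_rcons inE rcons_uniq => /and3P[/norP[/negbTE-> _] xt _].
  by rewrite -cats1 index_cat (negbTE xt) /= eqxx addn0.
have Ey : index y (y :: rcons t x) = 0 by rewrite /= eqxx.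
have my : y \in y :: rcons t x by rewrite inE eqxx.
have mx : x \in y :: rcons t x by rewrite inE mem_rcons inE eqxx orbT.
have mt u : u \in t -> u \in y :: rcons t x.
  by move=> ut; rewrite inE mem_rcons inE ut !orbT.
change (icyc (p ++ t)).
have cross u v : u \in p -> v \in t ->
    edge u v = cadj (size (p ++ t)) (index u (p ++ t)) (index v (p ++ t)).
  move=> up vt; rewrite size_cat !index_cat up (tp v vt) sp.
  have iv : index v t < size t by rewrite index_mem.
  case: (eqVneq u x) => [->|ux].
    rewrite (Et _ _ mx (mt _ vt)) Ex Eyt // ix /cadj /padj; clear -iv; lia.
  case: (eqVneq u y) => [->|uy].
    rewrite (Et _ _ my (mt _ vt)) Ey Eyt // iy /cadj /padj; clear -iv; lia.
  have ug := gi u up ux uy; have /negbTE-> : ~~ edge u v.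
    apply: contra (gX u ug) => uv; apply: (nbhI (tX v vt)); first by rewrite edge_sym.
    exact: pX.
  have : index u p < (size g).+2 by rewrite -sp index_mem.
  have : index u p <> 0 by rewrite /=; case: eqVneq ux => // ->; rewrite eqxx.
  have : index u p <> (size g).+1.
    by move=> iu; move: uy; rewrite -(nth_index y up) iu -iy nth_index // eqxx.
  move: (index u p) (index v t) iv; clear; rewrite /cadj /padj; lia.
split.
- rewrite cat_uniq U andTb; apply/andP; split; first by apply/hasPn=> u /tp->.
  by move: Ut; rewrite /= rcons_uniq => /and3P[].
- by rewrite size_cat sp; lia.
move=> u v; rewrite !mem_cat => /orP[up|ut] /orP[vp|vt].
- rewrite (ip.2 u v up vp) size_cat !index_cat up vp.
  have : index u p < size p by rewrite index_mem.
  have : index v p < size p by rewrite index_mem.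
  move: (index u p) (index v p) (size p) st; clear; rewrite /cadj /padj; lia.
- exact: cross.
- rewrite edge_sym cross //; move: (index _ _) (index _ _) (size _).
  by clear; rewrite /cadj /padj; lia.
- rewrite (Et _ _ (mt _ ut) (mt _ vt)) !Eyt // size_cat !index_cat !tp // sp.
  move: (index_mem u t) (index_mem v t); rewrite ut vt.
  by move: (index u t) (index v t); clear; rewrite /cadj /padj; lia.
Qed.

End Cycles.

(** * Wheels from an induced cycle and a connected set *)

Section Wheel.
Variable G : sgraph.

(* The label h k of the k-th rim vertex is the vertex of the target rim that it is
contracted to. *)
Lemma labelled_cycle_wheel (l : nat) (s : seq G) (z0 : G) (L : {set G}) (h : nat -> nat) :
  1 < l -> icyc s -> conn L -> (exists x, x \in L) ->
  (forall u, u \in s -> u \notin L) ->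
  h 0 = 0 -> h (size s).-1 = l.-1 ->
  (forall k, k.+1 < size s -> h k <= h k.+1 <= (h k).+1) ->
  (forall i, i < l -> exists k, [/\ k < size s, h k = i & nth z0 s k \in nbh L]) ->
  induced_minor (wheel l) G.
Proof.
move=> l1 [Us s3 Es] cL [u0 u0L] sL h0 hlast hstep hsurj.
have hmono k d : k + d < size s -> h k <= h (k + d).
  elim: d => [|d IH] kd; first by rewrite addn0.
  by rewrite addnS in kd *; have := hstep _ kd; have := IH (ltnW kd); lia.
have hl k : k < size s -> h k < l.
  move=> ks; have := hmono k ((size s).-1 - k).
  by rewrite subnKC ?hlast; lia.
(* The inner [None] is the hub. [insub] would also return it for a label of at least [l], which [hl]
   excludes. *)
pose f (x : G) : option (option 'I_l) :=
  if x \in L then Some None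
  else if x \in s then Some (insub (h (index x s))) else None.
have fL x : (f x == Some None) = (x \in L).
  rewrite /f; case: (x \in L) => //; case: (boolP (x \in s)) => // xs.
  by case: insubP => //; rewrite hl // index_mem.
have fs k (i : 'I_l) : k < size s -> h k = i -> f (nth z0 s k) = Some (Some i).
  move=> ks hk; have ms := mem_nth z0 ks.
  rewrite /f (negbTE (sL _ ms)) ms index_uniq // hk.
  by rewrite valK.
have fsE x (i : 'I_l) : f x = Some (Some i) ->
    exists k, [/\ k < size s, h k = i & x = nth z0 s k].
  rewrite /f; case: (x \in L) => //; case: (boolP (x \in s)) => // xs.
  case: insubP => // j _ hj [ij]; exists (index x s).
  by rewrite index_mem nth_index // -ij hj.
have Enth k k' : k < size s -> k' < size s ->
    edge (nth z0 s k) (nth z0 s k') = cadj (size s) k k'.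
  by move=> ks ks'; rewrite Es ?mem_nth // !index_uniq.
apply: (@model_induced_minor (wheel l) G f); split.
- case=> [i|]; last by exists u0; apply/eqP; rewrite fL.
  have [k [ks hk _]] := hsurj i (ltn_ord i).
  by exists (nth z0 s k); apply: fs.
- case=> [i|] P [x xi Px] Pcl y yi; last first.
    apply: (cL P); last by rewrite -fL; move: yi; rewrite inE.
      by exists x => //; rewrite -fL; move: xi; rewrite inE.
    by move=> u v uL vL; apply: Pcl; rewrite inE fL.
  (* Labels are monotone, so the positions with label [i] form an interval, along which [P] can be
     carried in both directions. *)
  have Pk k d : k + d < size s -> h k = i -> h (k + d) = i ->
      P (nth z0 s k) <-> P (nth z0 s (k + d)).
    elim: d => [|d IH] kd hk; first by rewrite addn0.
    rewrite addnS in kd * => hkd.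
    have hkd' : h (k + d) = i.
      by have := hmono k d (ltnW kd); have := hstep _ kd; lia.
    apply: (iff_trans (IH (ltnW kd) hk hkd')).
    have e1 : nth z0 s (k + d) \in [set x | f x == Some (Some i)].
      by rewrite inE (fs _ i (ltnW kd) hkd').
    have e2 : nth z0 s (k + d).+1 \in [set x | f x == Some (Some i)].
      by rewrite inE (fs _ i kd hkd).
    have e12 : edge (nth z0 s (k + d)) (nth z0 s (k + d).+1).
      by rewrite Enth ?(ltnW kd) // /cadj /padj eqxx.
    by split; [apply: Pcl | apply: Pcl => //; rewrite edge_sym].
  move: xi yi; rewrite !inE => /eqP/fsE[k [ks hk xk]] /eqP/fsE[k' [ks' hk' yk]].
  move: Px; rewrite xk yk; case: (leqP k k') => [kk'|/ltnW kk'].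
    by have := Pk k (k' - k); rewrite subnKC // => /(_ ks' hk hk')[].
  by have := Pk k' (k - k'); rewrite subnKC // => /(_ ks hk' hk)[].
- have spoke (i : 'I_l) : exists x y,
      [/\ f x = Some None, f y = Some (Some i) & edge x y].
    have [k [ks hk /nbhP[_ [x xL xy]]]] := hsurj i (ltn_ord i).
    exists x, (nth z0 s k); split=> //; last exact: fs.
    by apply/eqP; rewrite fL.
  (* The first position labelled [j] is preceded by one labelled [i]; for [j = 0] the edge that
     closes the cycle is used. *)
  have rim (i j : 'I_l) : j = ordS i -> exists x y,
      [/\ f x = Some (Some i), f y = Some (Some j) & edge x y].
    move/(congr1 val) => /=; case: (ltnP i.+1 l) => [il|li].
      rewrite modn_small // => ij.
      have ex : exists k, (k < size s) && (h k == j).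
        by have [k [ks hk _]] := hsurj j (ltn_ord j); exists k; rewrite ks hk eqxx.
      case: (ex_minnP ex) => -[|k] /andP[ks /eqP hk] kmin; first by lia.
      have hk' : h k = i.
        have := hstep _ ks; have : h k <> j; last by lia.
        by move=> hkj; have := kmin k; rewrite (ltnW ks) hkj eqxx; lia.
      exists (nth z0 s k), (nth z0 s k.+1); split; [exact/fs/hk'/ltnW|exact: fs|].
      by rewrite Enth ?(ltnW ks) // /cadj /padj eqxx.
    have -> : i.+1 = l by have := ltn_ord i; lia.
    rewrite modnn => j0; exists (nth z0 s (size s).-1), (nth z0 s 0).
    split; [apply: fs| apply: fs |]; rewrite ?h0 ?hlast ?Enth //; try lia.
      by have := ltn_ord i; lia.
    rewrite /cadj /padj; lia.
  have flip (a b : option 'I_l) :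
      (exists x y, [/\ f x = Some a, f y = Some b & edge x y]) ->
      exists x y, [/\ f x = Some b, f y = Some a & edge x y].
    by case=> x [y [fx fy xy]]; exists y, x; rewrite edge_sym.
  move=> [i|] [j|] // ij.
  2: by split=> // _; exact: (flip None (Some i) (spoke i)).
  split=> [/andP[_ /orP[/eqP|/eqP]]|].
  + exact: rim.
  + by move/rim/flip.
  case=> x [y [/fsE[k [ks hk ->]] /fsE[k' [ks' hk' ->]]]].
  rewrite Enth // => kk'.
  have ij' : i != j by apply: contraNneq ij => ->.
  have nij : h k <> h k' by rewrite hk hk' => /val_inj /eqP; apply/negP.
  have succ (a b : 'I_l) m : m.+1 < size s -> h m = a -> h m.+1 = b -> h m <> h m.+1 ->
      b = ordS a.
    move=> ms ha hb hab; apply: val_inj => /=.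
    have ab : a.+1 = b by have := hstep _ ms; lia.
    by rewrite ab modn_small.
  have wrap (a b : 'I_l) : h 0 = a -> h (size s).-1 = b -> a = ordS b.
    move=> ha hb; apply: val_inj => /=.
    have -> : b.+1 = l by rewrite -hb hlast prednK // ltnW.
    by rewrite modnn -ha h0.
  change ((i != j) && ((j == ordS i) || (i == ordS j))); rewrite ij' /=.
  case/orP: kk' => [/orP[]/eqP kE|/orP[]/andP[/eqP k0 /eqP kn]].
  + by rewrite kE in ks' hk' nij; rewrite (succ i j k) ?eqxx.
  + by rewrite kE in ks hk nij; rewrite (succ j i k') ?eqxx ?orbT // => /esym.
  + by rewrite (wrap i j) ?eqxx ?orbT -?k0 // -kn.
  + by rewrite (wrap j i) ?eqxx ?orbT -?k0 // -kn.
Qed.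

(** The cycle is rotated to start at an attachment of [L], and each further attachment opens a new
    label. Position [k] gets the number of attachments up to and including [k], minus one, capped at
    [l - 1] so that surplus attachments share the last label. *)
Lemma cycle_hub_wheel (l : nat) (s : seq G) (L : {set G}) :
  1 < l -> icyc s -> conn L -> (forall u, u \in s -> u \notin L) ->
  l <= count (mem (nbh L)) s -> induced_minor (wheel l) G.
Proof.
move=> l1; move: s => s0 cs cL sL la.
have /hasP[z zs az] : has (mem (nbh L)) s0 by rewrite has_count; lia.
case/splitPr: zs cs sL la => p q /icyc_rot cs sL.
rewrite count_cat addnC -count_cat => la.
have {}sL u : u \in (z :: q) ++ p -> u \notin L.
  by rewrite mem_cat orbC -mem_cat; apply: sL.
rewrite cat_cons in cs sL la; move: (q ++ p) cs sL la => {}q cs sL la.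
set s := z :: q in cs sL la; pose a : pred G := mem (nbh L).
have {}az : a z := az; have {}la : l <= count a s := la.
pose c k := count a (take k.+1 s).
have cS k : k.+1 < size s -> c k.+1 = c k + a (nth z s k.+1).
  by move=> ks; rewrite /c (take_nth z ks) -cats1 count_cat /= addn0.
have c0 : c 0 = 1 by rewrite /c /= take0 /= az.
have cn : c (size s).-1 = count a s by rewrite /c prednK // take_size.
have [_ [x xL _]] := nbhP _ _ az.
apply: (@labelled_cycle_wheel l s z L (fun k => minn (c k).-1 l.-1)) => //.
- by exists x.
- by rewrite c0 /= min0n.
- by rewrite cn; apply/minn_idPr; lia.
- by move=> k ks; rewrite (cS _ ks); case: (a _) => /=; lia.
move=> i il.
have ex : exists k, (k < size s) && (i < c k).
  by exists (size s).-1; rewrite cn; apply/andP; split=> //; lia.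
case: (ex_minnP ex) => -[|k] /andP[ks ik] kmin.
  by exists 0; split=> //; rewrite c0 in ik *; lia.
have ck : c k <= i.
  by rewrite leqNgt; apply/negP=> ick; have := kmin k; rewrite (ltnW ks) ick; lia.
exists k.+1; move: ik; rewrite (cS _ ks) => ik.
have ak : a (nth z s k.+1) by move: ik; case: (a _) => //; lia.
by split=> //; move: ik; rewrite ak; lia.
Qed.

End Wheel.

(** * Balanced cycles *)

Lemma min_exists (T : Type) (m : T -> nat) (P : T -> Prop) :
  (exists x, P x) -> exists x, P x /\ forall y, P y -> m x <= m y.
Proof.
case=> x Px; have [n] := ubnP (m x); elim: n x Px => // n IH x Px mx.
case: (pselect (exists y, P y /\ m y < m x)) => [[y [Py yx]]|no].
  by apply: (IH y) => //; lia.
exists x; split=> // y Py; rewrite leqNgt; apply/negP=> yx.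
by apply: no; exists y.
Qed.

Lemma split_first (T : Type) (a : pred T) (s : seq T) : has a s ->
  exists s1 z s2, [/\ s = s1 ++ z :: s2, a z & ~~ has a s1].
Proof.
elim: s => [|x s IH] //=; case: (boolP (a x)) => [ax _|Nax /= /IH].
  by exists [::], x, s.
by case=> s1 [z [s2 [-> az Na]]]; exists (x :: s1), z, s2; rewrite /= negb_or Nax.
Qed.

(** Gives rotations a normal form by their first vertex, so that two descriptions of one cycle from
    the same start can be compared. *)
Lemma rot_index_eq (T : eqType) (s a : seq T) (x : T) k :
  uniq s -> rot k s = x :: a -> rot (index x s) s = x :: a.
Proof.
move=> U; rewrite {1}/rot; have := cat_take_drop k s.
move: (take k s) (drop k s) => p [|y q] /= E; rewrite -{}E ?cats0 in U *.
  by move=> ->; rewrite /= eqxx rot0.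
case=> yx <-; move: U; rewrite yx cat_uniq => /and3P[_ /norP[xp _] _].
by rewrite index_cat (negbTE xp) /= eqxx addn0 rot_size_cat.
Qed.

Lemma card_bigcup_le (T : finType) (A : {set T}) (F : T -> {set T}) m :
  (forall x, x \in A -> #|F x| <= m) -> #|\bigcup_(x in A) F x| <= #|A| * m.
Proof.
move=> Fm; apply: (@leq_trans (\sum_(x in A) #|F x|)).
  elim/big_rec2: _ => [|x n S _ Sn]; first by rewrite cards0.
  by apply: leq_trans (leq_card_setU _ _) _; rewrite leq_add2l.
by rewrite -sum_nat_const; apply: leq_sum.
Qed.

Lemma cat_avoid (T : eqType) (q R g r : seq T) (y : T) :
  q ++ R = g ++ y :: r -> y \notin q -> exists h, g = q ++ h /\ R = h ++ y :: r.
Proof.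
elim: q g => [|c q IH] [|d g] //=; first by move=> ->; exists [::].
- by move=> ->; exists (d :: g).
- by case=> ->; rewrite mem_head.
by case=> -> /IH{}IH; rewrite inE negb_or => /andP[_ /IH[h [-> ->]]]; exists h.
Qed.

(** This locates [z] in the arc [r] outside a gap: [N] occurs on both sides of [z] but not in the
    two gap pieces [g2] and [g1], so [F1] reaches past [g2] and [F2] begins before [g1]. *)
Lemma between (T : Type) (N : pred T) (F1 F2 g1 g2 r : seq T) (x y z : T) :
  F1 ++ z :: F2 = g2 ++ y :: r ++ x :: g1 -> has N F1 -> has N F2 ->
  ~~ has N g2 -> ~~ has N g1 ->
  exists r1 r2, [/\ r = r1 ++ z :: r2, F2 = r2 ++ x :: g1 & F1 = g2 ++ y :: r1].
Proof.
move=> E NF1 NF2 Ng2 Ng1.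
have [r1 [EF1 E']] : exists r1, F1 = g2 ++ y :: r1 /\ r1 ++ z :: F2 = r ++ x :: g1.
  elim: g2 F1 E NF1 Ng2 => [|c g2 IH] [|f F1] //=.
    by case=> -> E _ _; exists F1.
  case=> -> E; rewrite negb_or => NF /andP[Nc Ng2]; rewrite (negbTE Nc) /= in NF.
  by have [r1 [-> ?]] := IH F1 E NF Ng2; exists r1.
have [r2 [Er EF2]] : exists r2, r = r1 ++ z :: r2 /\ F2 = r2 ++ x :: g1.
  elim: r1 r E' {E EF1} => [|c r1 IH] [|d r] /=.
  - by case=> _ E; rewrite E (negbTE Ng1) in NF2.
  - by case=> -> ->; exists r.
  - by case=> _ E; rewrite -E has_cat /= NF2 !orbT in Ng1.
  by case=> -> /IH[r2 [-> ->]]; exists r2.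
by exists r1, r2.
Qed.

Section CycleEdges.
Variable G : sgraph.
Implicit Types (p q s : seq G) (a b c : G).

Lemma ipath_edge p a b q : ipath (p ++ a :: b :: q) -> edge a b.
Proof.
move/ipath_catr=> [U ->]; rewrite ?inE ?eqxx ?orbT //=.
by move: U; rewrite /= inE => /andP[/norP[/negbTE-> _] _]; rewrite !eqxx.
Qed.

Lemma icyc_edge p a b q : icyc (p ++ a :: b :: q) -> edge a b.
Proof.
move/icyc_rot=> /= [U _ ->]; rewrite ?inE ?eqxx ?orbT //=.
by move: U; rewrite /= inE => /andP[/norP[/negbTE-> _] _]; rewrite !eqxx.
Qed.

Lemma ipath_stay (H T : {set G}) c q : ipath (c :: q) -> c \in H ->
  nbh H \subset T -> (forall u, u \in q -> u \notin T) -> {subset q <= H}.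
Proof.
elim: q c => [|d q IH] c // ip cH HT qT.
have dH : d \in H.
  apply: contraT => dH; have := qT d (mem_head _ _); rewrite (subsetP HT) //.
  exact: nbhI cH (@ipath_edge [::] _ _ _ ip) dH.
move=> u; rewrite inE => /predU1P[->//|uq].
apply: (IH d) => //; first exact: (@ipath_catr _ [:: c]).
by move=> v vq; apply: qT; rewrite inE vq orbT.
Qed.

Lemma icyc_rotk k s : icyc s -> icyc (rot k s).
Proof. by move=> cs; apply: icyc_rot; rewrite cat_take_drop. Qed.

Lemma cnbhP (D : {set G}) x :
  reflect (exists2 d, d \in D & x = d \/ edge d x) (x \in closed_nbhd D).
Proof.
rewrite inE; apply: (iffP exists_inP) => -[d dD].
  by case/predU1P=> ?; exists d => //; [left|right].
by case=> dx; exists d => //; rewrite dx ?eqxx ?orbT.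
Qed.

End CycleEdges.

(** * Big components left by small sets *)

Section Havens.
Variables (G : sgraph) (l : nat) (big : {set G} -> Prop).
Hypothesis l3 : 2 < l.
Hypothesis wheel_free : ~ induced_minor (wheel l) G.
Hypothesis big_meet : forall A B : {set G}, big A -> big B -> exists2 x, x \in A & x \in B.
Hypothesis big_sub : forall A B : {set G}, big A -> A \subset B -> big B.

(** [B] is a big component of the graph minus [T]. It is unique, because big sets meet. *)
Definition hcomp (T B : {set G}) :=
  [/\ conn B, big B, forall x, x \in B -> x \notin T & nbh B \subset T].

Hypothesis small_hcomp : forall S : {set G},
  #|S| <= (l - 1) ^ 2 -> exists B, hcomp S B.
Hypothesis dominated_hcomp : forall D : {set G},
  #|D| <= l -> exists B, hcomp (closed_nbhd D) B.

Implicit Types (A B X Y H S T : {set G}) (s p q g r t : seq G) (x y z : G).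

Lemma big_ex A : big A -> exists x, x \in A.
Proof. by move=> bA; have [x xA _] := big_meet bA bA; exists x. Qed.

Lemma big_conn_sub A B : conn A -> big A -> big B ->
  (forall x, x \in A -> x \notin nbh B) -> A \subset B.
Proof. by move=> cA bA bB; apply: conn_sub cA (big_meet bA bB). Qed.

Lemma hcomp_extend A T : conn A -> big A -> (forall x, x \in A -> x \notin T) ->
  exists B, hcomp T B /\ A \subset B.
Proof.
move=> cA bA AT; have [B [cB AB BT NB]] := conn_extend cA (big_ex bA) AT.
by exists B; split=> //; split=> //; apply: big_sub AB.
Qed.

(** This is balance of [s]: no component of its complement is big. *)
Definition hits s := forall B, conn B -> big B -> exists2 z, z \in B & z \in s.

Definition good s := icyc s /\ hits s.

(** [H] is a component of the complement of the cycle; with enough attachments it would contract to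
    the centre of a wheel. *)
Definition hub s H :=
  [/\ conn H, exists x, x \in H, forall u, u \in s -> u \notin H
    & {subset nbh H <= s}].

Lemma good_perm s s' : icyc s' -> s =i s' -> good s -> good s'.
Proof.
move=> cs' ss' [_ hs]; split=> // B cB bB.
by have [z zB zs] := hs B cB bB; exists z; rewrite -?ss'.
Qed.

Lemma hub_perm s s' H : s =i s' -> hub s H -> hub s' H.
Proof.
by move=> ss' [cH H0 sH Hs]; split=> // u; rewrite -ss'; [apply: sH|apply: Hs].
Qed.

Lemma nbh_hub_le s H : icyc s -> hub s H -> #|nbh H| <= l - 1.
Proof.
move=> cs [cH _ sH Hs]; rewrite leqNgt; apply/negP=> lH; apply: wheel_free.
apply: (@cycle_hub_wheel _ l s H) => //; first exact: ltnW.
apply: (@leq_trans #|nbh H|); first by lia.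
rewrite -size_filter; apply: leq_trans (card_size _).
by apply/subset_leq_card/subsetP=> u uH; rewrite mem_filter inE uH Hs.
Qed.

Lemma hub_not_big s H : hits s -> hub s H -> ~ big H.
Proof.
by move=> hs [cH _ sH _] bH; have [z zH /sH] := hs H cH bH; rewrite zH.
Qed.

(** * A dominating induced path and a first balanced cycle *)

Definition dompath p := forall B, conn B -> big B ->
  exists2 z, z \in B & z \in closed_nbhd [set x in p].

Lemma not_dompath p : ~ dompath p -> exists B,
  [/\ conn B, big B & forall z, z \in B -> z \notin closed_nbhd [set x in p]].
Proof.
move=> nd; apply: contrapT => no; apply: nd => B cB bB; apply: contrapT => nz.
apply: no; exists B; split=> // z zB; apply/negP=> zp; apply: nz.
by exists z.
Qed.

(** While the path does not dominate, the big component [A'] beyond its closed neighbourhood lies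
    strictly inside [A], and the path can be extended at [e] towards [A']. The size of [A] bounds
    the number of extensions. *)
Lemma dompath_grow n e p A : #|A| < n -> ipath (e :: p) -> conn A -> big A ->
  (forall x, x \in A -> x \notin closed_nbhd [set x in p]) -> e \in nbh A ->
  nbh A \subset closed_nbhd [set x in e :: p] ->
  exists q, ipath q /\ dompath q.
Proof.
elim: n e p A => // n IH e p A An iep cA bA Ap eA NA.
case: (pselect (dompath (e :: p))) => [|/not_dompath]; first by exists (e :: p).
case=> B [cB bB Bep]; have [A' [[cA' bA' A'ep NA'] _]] := hcomp_extend cB bB Bep.
have sA'A : A' \subset A.
  by apply: big_conn_sub => // x xA'; apply: contra (A'ep x xA'); apply: subsetP.
have [eNA [a aA ae]] := nbhP _ _ eA.
(* A neighbour of [e] in [A] is not in [A'], so the connected set [A] must leave [A']. The vertex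
   [v] found there is dominated by [e :: p] but not by [p], hence is adjacent to [e] alone. *)
have [v vA vA'] : exists2 v, v \in A & v \in nbh A'.
  apply: contrapT => no; have := A'ep a; rewrite (subsetP (_ : A \subset A')) //.
    by move/(_ isT)/cnbhP; apply; exists e; rewrite ?inE ?eqxx // edge_sym; right.
  by apply: big_conn_sub => // x xA; apply/negP=> xA'; apply: no; exists x.
have vp w : w \in p -> v != w /\ ~~ edge v w.
  move=> wp; split; apply/negP => vw; move: (Ap v vA) => /cnbhP; apply.
    by exists w; [rewrite inE|left; apply/eqP].
  by exists w; [rewrite inE|right; rewrite edge_sym].
have ve : v != e by apply: contraNneq eNA => <-.
have /cnbhP[d] := subsetP NA' v vA'; rewrite !inE => /predU1P[->|dp]; last first.
  have [vd Evd] := vp d dp.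
  by case=> [/eqP|]; rewrite ?(negbTE vd) // edge_sym (negbTE Evd).
case=> [/eqP|ev]; first by rewrite (negbTE ve).
apply: (IH v (e :: p) A') => //.
- apply: leq_trans (An : #|A| <= n); apply/proper_card/properP; split=> //.
  by exists v => //; apply: nbh_notin.
- apply: ipath_cons => //; last by move=> w /vp[].
    rewrite inE negb_or ve; apply/negP=> /vp[]; by rewrite eqxx.
  by rewrite edge_sym.
- apply: subset_trans NA' _; apply/subsetP=> w /cnbhP[d' d'p d'w].
  by apply/cnbhP; exists d' => //; move: d'p; rewrite !inE => ->; rewrite orbT.
Qed.

Lemma dompath_exists : exists q, ipath q /\ dompath q.
Proof.
have [C [cC bC _ NC]] : exists B, hcomp set0 B.
  by apply: small_hcomp; rewrite cards0.
have [v vC] := big_ex bC.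
have [A [cA bA Av NA]] : exists B, hcomp [set v] B.
  by apply: small_hcomp; rewrite cards1 expn_gt0; lia.
(* If [v] were not attached to [A], then [A] would have no neighbours at all and would contain the
   big component [C] of [v]. *)
have vNA : v \notin A by apply/negP=> /Av; rewrite inE eqxx.
have vA : v \in nbh A.
  apply: contraNT vNA => vNA; apply: (subsetP _ v vC).
  apply: big_conn_sub => // x _; apply: contra vNA => xA.
  by have := subsetP NA x xA; rewrite inE => /eqP <-.
apply: (@dompath_grow #|A|.+1 v [::] A) => //.
- split=> // x y; rewrite !inE => /eqP-> /eqP->.
  by rewrite edge_irrefl /= eqxx.
- by move=> x _; apply/cnbhP=> -[d]; rewrite inE.
- apply: subset_trans NA _; apply/subsetP=> x; rewrite inE => /eqP->.
  by apply/cnbhP; exists v; [rewrite !inE eqxx|left].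
Qed.

Lemma good_exists : exists s, good s.
Proof.
have [p [[ip dp] pmin]] := min_exists size dompath_exists.
(* Otherwise the path is a dominating set of at most [l] vertices, and the big component it leaves
   would avoid its closed neighbourhood. *)
have lp : l < size p.
  rewrite ltnNge; apply/negP=> pl.
  have [|B [cB bB BD _]] := @dominated_hcomp [set x in p].
    by apply: leq_trans pl; rewrite cardsE; apply: card_size.
  by have [z zB zD] := dp B cB bB; move: (BD z zB); rewrite zD.
have {}pmin q : ipath q -> size q < size p -> ~ dompath q.
  by move=> iq qp dq; have := pmin q (conj iq dq); rewrite leqNgt qp.
case: p => [|x p] in ip dp lp pmin *; first by [].
case/lastP: p => [|g y] in ip dp lp pmin *; first by move: lp => /=; lia.
rewrite /= size_rcons in lp pmin.
have ixg : ipath (x :: g) by move: ip; rewrite -cats1 -cat_cons => /ipath_catl.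
have igy : ipath (rcons g y) by move: ip; rewrite -cat1s => /ipath_catr.
have [|C [cC bC CN]] := not_dompath (pmin _ ixg _); first by rewrite /=; lia.
have [|C' [cC' bC' CN']] := not_dompath (pmin _ igy _).
  by rewrite size_rcons; lia.
have cX : conn (C :|: C') by apply: connU => //; apply: big_meet.
have mem_cn q u : u \in q -> u \in closed_nbhd [set x in q].
  by move=> uq; apply/cnbhP; exists u; [rewrite inE|left].
have adj_cn q u v : u \in q -> edge u v -> v \in closed_nbhd [set x in q].
  by move=> uq uv; apply/cnbhP; exists u; [rewrite inE|right].
have yC : y \notin C.
  apply/negP=> /CN/negP; apply; case/lastP: g ip lp {ixg igy pmin CN CN' dp} => [|g z ip _].
    by move=> _ /=; lia.
  apply: (@adj_cn _ z); first by rewrite inE mem_rcons mem_head orbT.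
  by move: ip; rewrite -!cats1 -catA -cat_cons => /ipath_edge.
have xC' : x \notin C'.
  apply/negP=> /CN'/negP; apply; case: g ip lp {ixg igy pmin CN CN' dp} => [|z g ip _].
    by move=> _ /=; lia.
  apply: (@adj_cn _ z); first by rewrite mem_head.
  by rewrite edge_sym; apply: (@ipath_edge _ [::] _ _ _ ip).
(* The whole path dominates a vertex of [C], and [C] avoids the closed neighbourhood of [x :: g], so
   only [y] can do so. *)
have yNC : y \in nbh C.
  have [z zC /cnbhP[d]] := dp C cC bC.
  rewrite [d \in _]inE in_cons mem_rcons in_cons orbCA => dxgy zd.
  have dy : d = y.
    case/predU1P: dxgy => // dxg; move: (CN z zC) => /cnbhP[].
    by exists d; rewrite ?inE.
  rewrite dy in zd; case: zd => [zy|yz]; first by rewrite -zy zC in yC.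
  by apply: (nbhI zC _ yC); rewrite edge_sym.
have xNC' : x \in nbh C'.
  have [z zC /cnbhP[d]] := dp C' cC' bC'.
  rewrite [d \in _]inE in_cons => dxgy zd.
  have dx : d = x.
    case/predU1P: dxgy => // dxg; move: (CN' z zC) => /cnbhP[].
    by exists d; rewrite ?inE.
  rewrite dx in zd; case: zd => [zx|xz]; first by rewrite -zx zC in xC'.
  by apply: (nbhI zC _ xC'); rewrite edge_sym.
have pX u : u \in x :: rcons g y -> u \notin C :|: C'.
  rewrite !inE mem_rcons inE negb_or => u_in; apply/andP; split.
    case: (eqVneq u y) => [->//|uy]; apply/negP=> /CN/negP; apply; apply: mem_cn.
    by move: u_in; rewrite (negbTE uy).
  case: (eqVneq u x) => [->//|ux]; apply/negP=> /CN'/negP; apply; apply: mem_cn.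
  by move: u_in; rewrite (negbTE ux) mem_rcons.
have xg : x \in x :: rcons g y by rewrite mem_head.
have yg : y \in x :: rcons g y by rewrite inE mem_rcons mem_head orbT.
have [||||t [t0 tX cs]] := close_path ip _ cX pX.
- by case: (g) lp => //=; lia.
- by have [_ [a aC ax]] := nbhP _ _ xNC'; apply: (nbhI _ ax (pX _ xg)); rewrite inE aC orbT.
- by have [_ [a aC ay]] := nbhP _ _ yNC; apply: (nbhI _ ay (pX _ yg)); rewrite inE aC.
- move=> u ug; apply/negP=> /nbhP[_ [a]]; rewrite inE => /orP[aC|aC] au.
    move/negP: (CN a aC); apply; apply: (@adj_cn _ u); last by rewrite edge_sym.
    by rewrite inE ug orbT.
  move/negP: (CN' a aC); apply; apply: (@adj_cn _ u); last by rewrite edge_sym.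
  by rewrite mem_rcons inE ug orbT.
exists (x :: rcons g y ++ t); split=> // K cK bK; apply: contrapT => nK.
have [|K' [[cK' bK' K's NK'] _]] := @hcomp_extend K [set v in x :: rcons g y ++ t] cK bK.
  by move=> u uK; rewrite in_set; apply/negP=> us; apply: nK; exists u.
have hK' : hub (x :: rcons g y ++ t) K'.
  split=> //; first exact: big_ex.
    by move=> u us; apply/negP=> uK; have := K's u uK; rewrite in_set => /negP; apply.
  by move=> u /(subsetP NK'); rewrite in_set.
have [|B [cB bB BD _]] := @dominated_hcomp (nbh K').
  by apply: leq_trans (nbh_hub_le cs hK') _; apply: leq_subr.
have BK' : B \subset K'.
  apply: big_conn_sub => // u /BD; apply: contra => uK'.
  by apply/cnbhP; exists u => //; left.
(* As [d] is on the cycle, it is not in [K']; being adjacent to [z] in [K'] it is an attachment,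
   whose closed neighbourhood [B] avoids. *)
have [z zB /cnbhP[d]] := dp B cB bB; rewrite inE => dp' zd.
have ds : d \in x :: rcons g y ++ t by rewrite -cat_cons mem_cat dp'.
have zK' := subsetP BK' z zB; have [_ _ sK' _] := hK'.
case: zd => [zd|dz]; first by move: (sK' d ds); rewrite -zd zK'.
move: (BD z zB) => /cnbhP; apply; exists d; last by right.
by apply: (nbhI zK' _ (sK' d ds)); rewrite edge_sym.
Qed.

(** * Rerouting a balanced cycle through a component *)

(* The cycle that leaves the gap x, g, y of X through t and avoids r. *)
Definition detour X x g y r t H :=
  [/\ {subset t <= X}, good (x :: g ++ y :: t), hub (x :: g ++ y :: t) H,
      x \in nbh H /\ y \in nbh H & {subset r <= H}].

(** In the main case [D] is [nbh H]. A big [B] that avoids [D] and meets [g] is disjoint from [H]. A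
    big set missing the new cycle meets [s] in [r], hence lies in [H] and cannot meet [B]; so the
    new cycle is balanced. Membership of [x] in [D] makes the union of these sets over all gaps
    contain [nbh X]. *)
Lemma gap_at s X k x g y r :
  good s -> hub s X -> rot k s = x :: g ++ y :: r ->
  x \in nbh X -> y \in nbh X -> (forall u, u \in g -> u \notin nbh X) ->
  exists D : {set G}, [/\ #|D| <= l - 1, x \in D & forall B, conn B -> big B ->
    (forall u, u \in B -> u \notin D) -> (exists2 z, z \in B & z \in g) ->
    exists t H, detour X x g y r t H].
Proof.
move=> gs hX Es xX yX gX.
have smem : s =i x :: g ++ y :: r by move=> u; rewrite -Es mem_rot.
have cs' : icyc (x :: g ++ y :: r) by rewrite -Es; apply: icyc_rotk; case: gs.
have gs' := good_perm cs' smem gs; have hX' := hub_perm smem hX.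
have D1 : #|[set x]| <= l - 1 by rewrite cards1; lia.
case: (eqVneq g [::]) => [->|g0].
  by exists [set x]; split=> //; [rewrite inE | move=> B _ _ _ []].
(* If [r] is empty, the gap already closes up to the whole cycle, and [X] serves as [H] with nothing
   rerouted. *)
case: r => [|r0 r] in Es smem cs' gs' hX' *.
  exists [set x]; split=> //; first by rewrite inE.
  by move=> B _ _ _ _; exists [::], X; split=> //.
have ip : ipath (x :: rcons g y).
  apply: (@icyc_ipath _ _ (r0 :: r)) => //.
  by rewrite cat_cons cat_rcons.
have [cX _ sX _] := hX'.
have pX u : u \in x :: rcons g y -> u \notin X.
  by move=> up; apply: sX; rewrite -cat_rcons -cat_cons mem_cat up.
have [t [t0 tX]] := close_path ip g0 cX pX xX yX gX.
rewrite cat_rcons => ct; set s' := x :: g ++ y :: t in ct.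
have r0s' u : u \in r0 :: r -> u \notin s'.
  move=> ur; have us : u \in x :: g ++ y :: r0 :: r.
    by rewrite -cat_rcons -cat_cons mem_cat ur orbT.
  rewrite /s' -cat_rcons -cat_cons mem_cat negb_or; apply/andP; split.
    case: cs' => + _ _; rewrite -cat_rcons -cat_cons cat_uniq => /and3P[_ /hasPn H _].
    exact: H.
  by apply/negP=> /tX uX; move: (sX u us); rewrite uX.
have [|||H [cH r0H Hs' NH]] := @conn_extend _ [set v in s'] [set r0].
- exact: conn1.
- by exists r0; rewrite inE.
- by move=> u; rewrite inE => /eqP->; rewrite in_set r0s' // mem_head.
have {}r0H : r0 \in H by apply: (subsetP r0H); rewrite inE.
have hH : hub s' H.
  split=> //; first by exists r0.
    by move=> u us; apply/negP=> /Hs'; rewrite in_set us.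
  by move=> u /(subsetP NH); rewrite in_set.
have rH : {subset r0 :: r <= H}.
  move=> u; rewrite inE => /predU1P[->//|]; move: u.
  apply: ipath_stay (r0H) NH _; last by move=> u ur; rewrite in_set r0s' // inE ur orbT.
  apply: (@icyc_ipath _ _ (x :: rcons g y)) => //; apply: icyc_rot.
  by rewrite cat_cons cat_rcons.
have [_ _ sH' Hsub] := hH.
have xH : x \in nbh H.
  have [r' [e Er]] : exists r' e, r0 :: r = rcons r' e.
    by case/lastP: (r) => [|r' e]; [exists [::], r0 | exists (r0 :: r'), e].
  apply: (@nbhI _ _ e); last by apply: sH'; rewrite mem_head.
    by apply: rH; rewrite Er mem_rcons mem_head.
  apply: (@icyc_edge _ r' e x (rcons g y)).
  rewrite -cat_rcons -Er; apply: icyc_rot; by rewrite cat_cons cat_rcons.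
have yH : y \in nbh H.
  apply: (nbhI r0H); last by apply: sH'; rewrite inE mem_cat mem_head !orbT.
  by rewrite edge_sym; apply: (@icyc_edge _ (x :: g) y r0 r).
exists (nbh H); split=> // [|B cB bB BH [z zB zg]]; first exact: nbh_hub_le hH.
have BnH u : u \in B -> u \notin H.
  move=> uB; apply/negP=> uH; have BH' : B \subset H.
    by apply: conn_sub => //; exists u.
  by move: (sH' z); rewrite (subsetP BH' z zB) inE mem_cat zg orbT => /(_ isT).
exists t, H; split=> //; split=> // B0 cB0 bB0; apply: contrapT => no.
have [z0 z0B z0s] := gs.2 B0 cB0 bB0.
have z0H : z0 \in H.
  apply: rH; move: z0s; rewrite smem -cat_rcons -cat_cons mem_cat => /orP[z0p|//].
  by case: no; exists z0 => //; rewrite /s' -cat_rcons -cat_cons mem_cat z0p.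
have B0H : B0 \subset H.
  apply: conn_sub => //; first by exists z0.
  by move=> u uB0; apply/negP=> /Hsub us; apply: no; exists u.
by have [u uB /(subsetP B0H) uH] := big_meet bB bB0; move: (BnH u uB); rewrite uH.
Qed.

Lemma gap_cover s (N : {set G}) z : uniq s -> {subset N <= s} -> z \in s ->
  z \notin N -> (exists x, x \in N) ->
  exists x q p, [/\ x \in N, rot (index x s) s = x :: q ++ z :: p & ~~ has (mem N) q].
Proof.
move=> U Ns zs zN [w wN]; have E := rot_index zs.
move: (drop _ _ ++ _) E => q /= E.
have /split_last[q1 [x [q2 [Eq xN Nq2]]]] : has (mem N) q.
  apply/hasP; exists w => //; have : w \in rot (index z s) s by rewrite mem_rot; apply: Ns.
  rewrite E inE.
  by case/predU1P => // wz; rewrite -wz wN in zN.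
exists x, q2, q1; split=> //.
have sz : (size q1).+1 <= size s.
  by have := congr1 size E; rewrite size_rot Eq /= size_cat => ->; lia.
have : rot (size q1).+1 (rot (index z s) s) = x :: q2 ++ z :: q1.
  by rewrite E Eq -cat_cons (_ : (size q1).+1 = size (z :: q1)) // rot_size_cat.
by rewrite rot_add_mod ?index_size //; apply: rot_index_eq.
Qed.

(** Each gap is indexed by its starting attachment. The union of the sets [D x] has at most
    [(l - 1) ^ 2] vertices; the big component it leaves meets the balanced cycle inside some gap,
    and this gap gives the detour. Two attachments ensure that the ends of a gap differ. *)
Lemma gap_step s X : good s -> hub s X -> 1 < #|nbh X| ->
  exists k x g y r t H, [/\ rot k s = x :: g ++ y :: r, x \in nbh X, y \in nbh X,
    forall u, u \in g -> u \notin nbh X & detour X x g y r t H].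
Proof.
move=> gs hX X2; have [_ _ sX Xs] := hX; have [cs hs] := gs; have [U _ _] := cs.
pose P x (D : {set G}) := x \in nbh X -> exists g y r,
  [/\ rot (index x s) s = x :: g ++ y :: r, y \in nbh X,
      ~~ has (mem (nbh X)) g, #|D| <= l - 1 /\ x \in D &
      forall B, conn B -> big B ->
        (forall u, u \in B -> u \notin D) -> (exists2 z, z \in B & z \in g) ->
      exists t H, detour X x g y r t H].
have /choice[D DP] : forall x, exists D, P x D.
  move=> x; case: (boolP (x \in nbh X)) => [xX|]; last first.
    by move=> xX; exists set0 => xX'; rewrite xX' in xX.
  have xs := Xs x xX; have E := rot_index xs; move: (drop _ _ ++ _) E => a /= E.
  have /split_first[g [y [r [Ea yX gX]]]] : has (mem (nbh X)) a.
    have : 0 < #|nbh X :\ x| by move: X2; rewrite (cardsD1 x) xX; lia.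
    case/card_gt0P=> w /setD1P[wx wX]; apply/hasP; exists w => //.
    have : w \in rot (index x s) s by rewrite mem_rot; apply: Xs.
    by rewrite E inE (negbTE wx).
  rewrite Ea in E.
  have [|D [D1 xD DB]] := gap_at gs hX E xX yX.
    by move=> u ug; apply: contra gX => uX; apply/hasP; exists u.
  by exists D => _; exists g, y, r.
have [B [cB bB BS _]] : exists B, hcomp (\bigcup_(x in nbh X) D x) B.
  apply: small_hcomp; apply: leq_trans (card_bigcup_le (m := l - 1) _) _.
    by move=> x xX; have [g [y [r [_ _ _ [D1 _] _]]]] := DP x xX.
  by rewrite -mulnn leq_mul2r (nbh_hub_le cs hX) orbT.
have BD x u : x \in nbh X -> u \in B -> u \notin D x.
  by move=> xX uB; apply: contra (BS u uB) => uD; apply/bigcupP; exists x.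
have [z zB zs] := hs B cB bB.
have zX : z \notin nbh X.
  apply/negP=> zX; have [g [y [r [_ _ _ [_ zD] _]]]] := DP z zX.
  by move: (BD z z zX zB); rewrite zD.
have [|x [q [p [xX E Nq]]]] := gap_cover U Xs zs zX.
  by apply/card_gt0P; lia.
have [g [y [r [E' yX gX [_ _] DB]]]] := DP x xX.
(* Both [g] and [q] start right after [x]; [y] is the first attachment there, and none occurs up to
   [z]. *)
have zg : z \in g.
  have {}U : uniq (q ++ z :: p).
    by move: U; rewrite -(rot_uniq (index x s) s) E => /andP[].
  move: E'; rewrite E => -[]; elim: g q U Nq {E DB} gX => [|c g IH] [|d q] /=.
  - by move=> _ _ _ [zy]; rewrite zy yX in zX.
  - by move=> _ /norP[dX _] _ [dy]; rewrite dy /= yX in dX.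
  - by move=> _ _ _ [-> _]; rewrite mem_head.
  - move=> /andP[_ U] /norP[_ Nq] /norP[_ gX] [_ E].
    by rewrite inE (IH q U Nq gX E) orbT.
have [t [H dH]] := DB B cB bB (BD x^~ xX) (ex_intro2 _ _ z zB zg).
exists (index x s), x, g, y, r, t, H; split=> //.
by move=> u ug; apply: contra gX => uX; apply/hasP; exists u.
Qed.

Lemma four_le_bound : 4 <= (l - 1) ^ 2.
Proof. by rewrite -[4]/(2 ^ 2) leq_exp2r //; lia. Qed.

(** * Minimal separations by two cycle vertices or by a component *)

Definition arcsep Y := exists a I b q,
  [/\ good (a :: I ++ b :: q), hcomp [set a; b] Y
    & forall u, u \in a :: I ++ b :: q -> u \in Y -> u \in I].

Definition hubsep Y := exists s H,
  [/\ good s, hub s H, 1 < #|nbh H| & hcomp (nbh H) Y].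

Lemma hub_disjoint s H Y : hits s -> hub s H -> conn Y -> big Y ->
  (forall u, u \in Y -> u \notin nbh H) -> forall u, u \in Y -> u \notin H.
Proof.
move=> hs hH cY bY YH u uY; apply/negP=> uH; apply: (hub_not_big hs hH).
by apply: big_sub bY _; apply: conn_sub => //; exists u.
Qed.

(** The big component left by [nbh H] avoids [H] and [nbh H], which together contain the boundary of
    [Y], so it cannot leave [Y]. *)
Lemma sep_shrink s H Y : good s -> hub s H -> conn Y -> big Y ->
  (forall u, u \in nbh Y -> u \in H \/ u \in nbh H) ->
  exists Y', [/\ hcomp (nbh H) Y', Y' \subset Y & forall u, u \in Y' -> u \notin H].
Proof.
move=> [cs hs] hH cY bY NY.
have [Y' hY'] : exists Y', hcomp (nbh H) Y'.
  apply: small_hcomp; apply: leq_trans (nbh_hub_le cs hH) _.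
  by rewrite -mulnn leq_pmulr //; lia.
have [cY' bY' Y'H _] := hY'; have Y'H' := hub_disjoint hs hH cY' bY' Y'H.
exists Y'; split=> //; apply: big_conn_sub => // u uY'; apply/negP=> /NY[].
  by apply/negP/Y'H'.
by apply/negP/Y'H.
Qed.

(** A detour across a gap of [H] gives a component [H'] containing [r]. By minimality [Y] is also
    the big component left by [nbh H'], so neither [Y] nor its boundary meets [r]. Hence the ends
    [x], [y] of the gap separate [Y] on the original cycle. *)
Lemma hubsep_arcsep Y : hubsep Y -> (forall Y', hubsep Y' -> #|Y| <= #|Y'|) -> arcsep Y.
Proof.
case=> s [H [gs hH H2 [cY bY YH NY]]] Ymin.
have [k [x [g [y [r [t [H' [E xH yH gH [tH gs' hH' [xH' yH'] rH']]]]]]]]] := gap_step gs hH H2.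
have smem : s =i x :: g ++ y :: r by move=> u; rewrite -E mem_rot.
have [_ _ _ Hs] := hH; have [_ _ sH' Hs'] := hH'.
have Ur : uniq (x :: g ++ y :: r) by rewrite -E rot_uniq; case: gs => -[].
have xy : x != y.
  by move: Ur => /andP[+ _]; rewrite mem_cat inE !negb_or => /and3P[_ ? _].
have Hxyr u : u \in nbh H -> [\/ u = x, u = y | u \in r].
  move=> uH; have := Hs u uH; rewrite smem inE mem_cat inE.
  case/or4P=> [/eqP||/eqP|]; [by constructor 1 | | by constructor 2 | by constructor 3].
  by move=> /gH; rewrite uH.
have HH' u : u \in nbh H -> u \in H' \/ u \in nbh H'.
  by case/Hxyr=> [->|->|/rH']; [right|right|left].
have [|Y' [hY' Y'Y Y'H']] := sep_shrink gs' hH' cY bY.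
  by move=> u /(subsetP NY)/HH'.
have EY : Y' = Y.
  apply/eqP; rewrite eqEcard Y'Y /=; apply: Ymin; exists (x :: g ++ y :: t), H'.
  split=> //; apply: (@leq_trans #|[set x; y]|); first by rewrite cards2 xy.
  by apply/subset_leq_card/subsetP=> u /set2P[]->.
rewrite {Y' Y'Y}EY in hY' Y'H'; have [_ _ YH' NY'] := hY'.
have gr : good (x :: g ++ y :: r).
  by apply: (good_perm _ smem gs); rewrite -E; apply: icyc_rotk; case: gs.
exists x, g, y, r; split=> //; last first.
  move=> u; rewrite inE mem_cat inE => /or4P[/eqP->|//|/eqP->|/rH' uH'] uY.
  - by move: (YH' x uY); rewrite xH'.
  - by move: (YH' y uY); rewrite yH'.
  - by move: (Y'H' u uY); rewrite uH'.
split=> //.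
  move=> u uY; rewrite !inE; apply/norP; split; apply/eqP=> ux; move: (YH u uY).
    by rewrite ux xH.
  by rewrite ux yH.
apply/subsetP=> u uY; rewrite !inE.
case/Hxyr: (subsetP NY u uY) => [->|->|/rH' uH']; rewrite ?eqxx ?orbT //.
by move: (nbh_notin (subsetP NY' u uY)); rewrite uH'.
Qed.

Definition minsep a b Y := [/\ conn Y, big Y, forall u, u \in Y -> u \notin [set a; b],
  nbh Y \subset [set a; b] & forall Y', arcsep Y' \/ hubsep Y' -> #|Y| <= #|Y'|].

Lemma minsep_exists : exists a I b q Y, [/\ good (a :: I ++ b :: q), minsep a b Y
  & forall u, u \in a :: I ++ b :: q -> u \in Y -> u \in I].
Proof.
have [|Y [sY Ymin]] := @min_exists _ (fun Y => #|Y|) (fun Y => arcsep Y \/ hubsep Y).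
  have [s gs] := good_exists.
  (* Two consecutive vertices of any balanced cycle will do, with the outer arc empty. *)
  have [a [I [b Es]]] : exists a I b, s = a :: rcons I b.
    case: s gs => [|a s] [[_]] //; case/lastP: s => [|I b] //.
    by exists a, I, b.
  have [Y hY] : exists Y, hcomp [set a; b] Y.
    apply: small_hcomp; apply: (@leq_trans 2); first by rewrite cards2; case: (_ != _).
    exact: leq_trans four_le_bound.
  exists Y; left; exists a, I, b, [::]; rewrite cats1 -Es; split=> // u.
  rewrite Es inE mem_rcons inE orbA => /orP[uab|//] uY.
  by case: hY => _ _ /(_ u uY); rewrite !inE uab.
have [a [I [b [q [gs [cY bY YT NY] YI]]]]] : arcsep Y.
  by case: sY => // sY; apply: hubsep_arcsep => // Y' sY'; apply: Ymin; right.
by exists a, I, b, q, Y.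
Qed.

(** The big component left by [nbh H] would lie in [Y] and miss [u], against minimality. The
    contradictions below are drawn from this. *)
Lemma minsep_hub a b Y s H : minsep a b Y -> good s -> hub s H -> 1 < #|nbh H| ->
  (a \in H \/ a \in nbh H) -> (b \in H \/ b \in nbh H) ->
  (exists2 u, u \in Y & u \in H \/ u \in nbh H) -> False.
Proof.
move=> [cY bY YT NY Ymin] gs hH H2 aH bH [u uY uH].
have [|Y' [hY' Y'Y Y'H]] := sep_shrink gs hH cY bY.
  by move=> v /(subsetP NY)/set2P[]->.
have : #|Y| <= #|Y'| by apply: Ymin; right; exists s, H.
move=> YY'; have {}Y'Y : Y' = Y by apply/eqP; rewrite eqEcard Y'Y.
have [_ _ YH _] := hY'; rewrite Y'Y in YH Y'H.
by case: uH => uH; [move: (Y'H u uY) | move: (YH u uY)]; rewrite uH.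
Qed.

Lemma minsep_nbh a b Y X w : minsep a b Y -> X \subset Y -> w \in nbh X ->
  [\/ w \in Y, w = a | w = b].
Proof.
move=> [_ _ _ NY _] XY /nbhP[_ [x xX xw]].
case: (boolP (w \in Y)) => wY; first by constructor 1.
have := subsetP NY w (nbhI (subsetP XY x xX) xw wY); rewrite !inE.
by case/orP=> /eqP; [constructor 2|constructor 3].
Qed.

(** * Components that jump over a cycle vertex *)

Lemma hub_of s u : u \notin s -> exists H, hub s H /\ u \in H.
Proof.
move=> us; have [|||H [cH uH Hs NH]] := @conn_extend _ [set v in s] [set u].
- exact: conn1.
- by exists u; rewrite inE.
- by move=> v; rewrite inE => /eqP->; rewrite in_set.
have {}uH : u \in H by apply: (subsetP uH); rewrite inE.
exists H; split=> //; split=> //; first by exists u.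
  by move=> v vs; apply/negP=> /Hs; rewrite in_set vs.
by move=> v /(subsetP NH); rewrite in_set.
Qed.

(** Being on the side of [A2] spreads along the edges of [U]: a vertex on the cycle belongs to [A2],
    and a vertex off it lies in a component attached to [A2]. As the boundary of [U] is on the
    cycle, such a component stays inside [U]. *)
Lemma one_sided s U (A1 A2 : seq G) u0 :
  conn U -> nbh U \subset [set v in s] ->
  {subset A1 <= s} -> {subset A2 <= s} -> (forall u, u \in A1 -> u \notin A2) ->
  (forall u, u \in s -> u \in U -> u \in A1 \/ u \in A2) ->
  (forall u v, u \in A1 -> v \in A2 -> u \in U \/ v \in U -> ~~ edge u v) ->
  (forall X, hub s X -> X \subset U -> forall w z, w \in nbh X -> w \in A1 ->
    z \in nbh X -> z \in A2 -> False) ->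
  u0 \in U -> u0 \in A2 -> forall u, u \in A1 -> u \notin U /\ u \notin nbh U.
Proof.
move=> cU NU A1s A2s A12 UA noE noX u0U u0A2.
have XU X v : hub s X -> v \in X -> v \in U -> X \subset U.
  move=> [cX _ sX _] vX vU; apply: conn_sub => //; first by exists v.
  by move=> u uX; apply/negP=> /(subsetP NU); rewrite in_set => /sX; rewrite uX.
pose P v := (v \in s -> v \in A2) /\
  (v \notin s -> forall X, hub s X -> v \in X -> exists2 z, z \in nbh X & z \in A2).
have PU : forall v, v \in U -> P v.
  apply: cU.
    by exists u0 => //; split=> // ; rewrite A2s.
  move=> v v' vU v'U vv' [Pv1 Pv2].
  case: (boolP (v \in s)) => vs; last first.
    have [X0 [hX0 vX0]] := hub_of vs; have [z zX0 zA2] := Pv2 vs X0 hX0 vX0.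
    have [_ _ sX0 X0s] := hX0; split=> [v's|v's X hX v'X].
      have v'X0 : v' \in nbh X0 by apply: nbhI vX0 vv' _; apply: sX0.
      have [v'A1|//] := UA v' v's v'U.
      by case: (noX X0 hX0 (XU X0 v hX0 vX0 vU) v' z).
    apply: (Pv2 vs X hX); apply: contraNT vs => vX; have [_ _ _ Xs] := hX.
    by apply: Xs; apply: nbhI v'X _ vX; rewrite edge_sym.
  have vA2 := Pv1 vs; split=> [v's|v's X hX v'X].
    have [v'A1|//] := UA v' v's v'U.
    by move: (noE v' v v'A1 vA2 (or_introl v'U)); rewrite edge_sym vv'.
  have [_ _ sX _] := hX; exists v => //.
  by apply: nbhI v'X _ (sX v vs); rewrite edge_sym.
move=> u uA1; have us := A1s u uA1; split.
  by apply/negP=> /PU[/(_ us) uA2 _]; move: (A12 u uA1); rewrite uA2.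
apply/negP=> /nbhP[uU [v vU vu]]; have [Pv1 Pv2] := PU v vU.
case: (boolP (v \in s)) => [/Pv1 vA2|vs].
  by move: (noE u v uA1 vA2 (or_intror vU)); rewrite edge_sym vu.
have [X0 [hX0 vX0]] := hub_of vs; have [z zX0 zA2] := Pv2 vs X0 hX0 vX0.
have [_ _ sX0 _] := hX0.
by apply: (noX X0 hX0 (XU X0 v hX0 vX0 vU) u z) => //; apply: nbhI vX0 vu (sX0 u us).
Qed.

Lemma ipath_nonadj p c q u v : ipath (p ++ c :: q) -> u \in p -> v \in q -> ~~ edge u v.
Proof.
case=> U E up vq; rewrite E ?mem_cat ?inE ?up ?vq ?orbT // !index_cat up.
move: U; rewrite cat_uniq => /and3P[_ /hasPn pq /andP[cq _]].
have /negbTE-> : v \notin p by apply: pq; rewrite inE vq orbT.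
have /negbTE cv : c != v by apply: contraNneq cq => ->.
have : index u p < size p by rewrite index_mem.
by rewrite /= cv /padj; clear; lia.
Qed.

(** If no component jumped over [c], the big component [U] left by [a], [c], [b] would stay on one
    side of [c]. Then [a], [c] or [c], [b] alone would separate it, and it is smaller than [Y] since
    it misses [c]. *)
Lemma crossing a b Y I1 (c : G) I2 q :
  minsep a b Y -> good (a :: (I1 ++ c :: I2) ++ b :: q) ->
  (forall u, u \in a :: (I1 ++ c :: I2) ++ b :: q -> u \in Y -> u \in I1 ++ c :: I2) ->
  c \in Y ->
  exists X w z, [/\ hub (a :: (I1 ++ c :: I2) ++ b :: q) X, X \subset Y,
    w \in nbh X /\ w \in a :: I1 & z \in nbh X /\ z \in rcons I2 b].
Proof.
move=> mY gs YI cYY; have [cY bY YT NY Ymin] := mY.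
set s := a :: (I1 ++ c :: I2) ++ b :: q in gs YI *.
have Es : s = (a :: I1) ++ c :: rcons I2 b ++ q.
  by rewrite /s -catA /= cat_rcons.
apply: contrapT => no.
have [U [cU bU UT NU]] : exists U, hcomp [set a; c; b] U.
  apply: small_hcomp; apply: (@leq_trans 3).
    by rewrite setUC cardsU1 cards2; case: (_ \notin _); case: (_ != _).
  exact: leq_trans four_le_bound.
have Uu u : u \in U -> [/\ u != a, u != c & u != b].
  by move=> /UT; rewrite !inE !negb_or -andbA => /and3P.
have UY : U \subset Y.
  apply: big_conn_sub => // u /Uu[ua _ ub]; apply/negP=> /(subsetP NY).
  by rewrite !inE (negbTE ua) (negbTE ub).
have ltUY : #|U| < #|Y|.
  apply/proper_card/properP; split=> //; exists c => //.
  by apply/negP=> /Uu[_]; rewrite eqxx.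
have sA1 : {subset a :: I1 <= s} by move=> u uA; rewrite Es mem_cat uA.
have sA2 : {subset rcons I2 b <= s}.
  by move=> u uA; rewrite Es -cat_rcons !mem_cat uA !orbT.
have NUs : nbh U \subset [set v in s].
  apply/subsetP=> u /(subsetP NU) /setUP[/set2P[]|/set1P] ->.
  - by rewrite in_set mem_head.
  - by rewrite in_set Es mem_cat mem_head orbT.
  - by rewrite in_set; apply: sA2; rewrite mem_rcons mem_head.
have A12 u : u \in a :: I1 -> u \notin rcons I2 b.
  move=> uA1; have [[]] := gs; rewrite Es cat_uniq => /and3P[_ /hasPn H _] _ _ _.
  by apply: contraL uA1 => uA2; apply: H; rewrite inE mem_cat uA2 orbT.
have UA u : u \in s -> u \in U -> u \in I1 \/ u \in I2.
  move=> us uU; have := YI u us (subsetP UY u uU); have [_ /negbTE up _] := Uu u uU.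
  by rewrite mem_cat inE up => /orP.
(* The only possible edge past [c] is [a b], when [q] is empty, and neither of its ends is in
   [U]. *)
have noE u v : u \in a :: I1 -> v \in rcons I2 b -> u \in U \/ v \in U -> ~~ edge u v.
  move=> uA vA uvU.
  have cs : icyc ((a :: I1) ++ c :: rcons I2 b ++ q) by rewrite -Es; case: gs.
  case: (boolP (v \in I2)) => [vI2|vI2].
    apply: (@ipath_nonadj (a :: I1) c I2) => //.
    apply: (@icyc_ipath _ _ (b :: q)) => //.
    by move: cs; rewrite cat_rcons -catA.
  have vb : v = b by move: vA; rewrite mem_rcons inE (negbTE vI2) orbF => /eqP.
  have uI1 : u \in I1.
    move: uA; rewrite inE => /predU1P[ua|//]; rewrite vb ua in uvU.
    by case: uvU => /Uu[]; rewrite eqxx.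
  apply: (@ipath_nonadj I1 c (rcons I2 b)) => //.
  apply: (@icyc_ipath _ _ (rcons q a)); last by case: (q).
  have := @icyc_rot _ [:: a] _ cs; by rewrite -!catA /= -!cats1 -!catA /=.
have noX X : hub s X -> X \subset U -> forall w z, w \in nbh X -> w \in a :: I1 ->
    z \in nbh X -> z \in rcons I2 b -> False.
  move=> hX XU w z wX wA zX zA; apply: no; exists X, w, z; split=> //.
  exact: subset_trans XU UY.
have [u0 u0U u0s] := gs.2 U cU bU.
have sepU Y' : arcsep Y' -> Y' = U -> False.
  by move=> aY' EY; have := Ymin Y' (or_introl aY'); rewrite EY leqNgt ltUY.
case: (UA u0 u0s u0U) => u0I; apply: (sepU U) => //.
- have side : forall u, u \in rcons I2 b -> u \notin U /\ u \notin nbh U.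
    apply: (@one_sided s U (rcons I2 b) (a :: I1) u0) => //.
    + by move=> u; apply: contraL => /A12.
    + by move=> u us uU; case: (UA u us uU) => uI; [right|left];
        rewrite ?mem_rcons inE uI orbT.
    + by move=> u v uA vA uv; rewrite edge_sym; apply: noE => //; case: uv; [right|left].
    + by move=> X hX XU w z wX wA zX zA; apply: (noX X hX XU z w).
    + by rewrite inE u0I orbT.
  exists a, I1, c, (rcons I2 b ++ q); split; first by rewrite -cat_cons -Es.
    split=> //.
      by move=> u /Uu[ua up _]; rewrite !inE negb_or ua up.
    apply/subsetP=> u uU; have := subsetP NU u uU; rewrite !inE => /orP[->//|/eqP ub].
    by have [|_] := side u; rewrite ?uU // ub mem_rcons mem_head.
  move=> u; rewrite -cat_cons -Es => us uU; have [//|uI2] := UA u us uU.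
  by have [|] := side u; rewrite ?uU // mem_rcons inE uI2 orbT.
- have side : forall u, u \in a :: I1 -> u \notin U /\ u \notin nbh U.
    apply: (@one_sided s U (a :: I1) (rcons I2 b) u0) => //.
    + by move=> u us uU; case: (UA u us uU) => uI; [left|right];
        rewrite ?mem_rcons inE uI orbT.
    + by rewrite mem_rcons inE u0I orbT.
  have sm : s =i c :: I2 ++ b :: (q ++ a :: I1).
    by move=> u; rewrite Es mem_cat orbC -mem_cat cat_cons cat_rcons -catA.
  exists c, I2, b, (q ++ a :: I1); split.
  + apply: (good_perm _ sm gs).
    have := icyc_rot (_ : icyc ((a :: I1) ++ (c :: rcons I2 b ++ q))).
    rewrite -Es cat_cons cat_rcons -catA; apply; by case: gs.
  + split=> //.
      by move=> u /Uu[_ up ub]; rewrite !inE negb_or ub up.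
    apply/subsetP=> u uU; have := subsetP NU u uU; rewrite !inE -orbA.
    case/orP=> [/eqP ua|//].
    by have [|_] := side u; rewrite ?uU // ua mem_head.
  + move=> u; rewrite -sm => us uU; have [uI1|//] := UA u us uU.
    by have [|] := side u; rewrite ?uU // inE uI1 orbT.
Qed.

(** * Shortening the tail *)

(* The component H is attached to a and z, and I2 is the tail to be shortened;
the arc b, q, a is kept fixed. *)
Definition tailsep a b q Y (T : seq G * G * seq G * {set G}) :=
  let: (I1, z, I2, H) := T in let s := a :: (I1 ++ z :: I2) ++ b :: q in
  [/\ good s /\ (forall u, u \in s -> u \in Y -> u \in I1 ++ z :: I2),
      hub s H, H \subset Y, a \in nbh H & z \in nbh H].

Lemma cycle_neq a I b q : good (a :: I ++ b :: q) ->
  [/\ a != b, a \notin I, b \notin I & forall u, u \in q -> [/\ u \notin I, u != a & u != b]].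
Proof.
case=> -[+ _ _] _; rewrite cons_uniq mem_cat inE negb_or cat_uniq /=.
case/and5P=> /andP[aI /norP[ab aq]] _ /norP[bI /hasPn qI] bq _; split=> // u uq.
split; first exact: qI.
  by apply: contraNneq aq => <-.
by apply: contraNneq bq => <-.
Qed.

Lemma card_nbh2 H x y : x \in nbh H -> y \in nbh H -> x != y -> 1 < #|nbh H|.
Proof.
move=> xH yH xy; apply: (@leq_trans #|[set x; y]|); first by rewrite cards2 xy.
by apply/subset_leq_card/subsetP=> u /set2P[]->.
Qed.

Lemma minsep_both_ends a I b q Y H : minsep a b Y -> good (a :: I ++ b :: q) ->
  hub (a :: I ++ b :: q) H -> H \subset Y -> a \in nbh H -> b \in nbh H -> False.
Proof.
move=> mY gs hH HY aH bH; have [ab _ _ _] := cycle_neq gs.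
apply: (minsep_hub mY gs hH (card_nbh2 aH bH ab)); [by right | by right|].
by have [_ [h hH'] _ _] := hH; exists h; [apply: (subsetP HY) | left].
Qed.

Lemma tailsep_exists a I b q Y : minsep a b Y -> good (a :: I ++ b :: q) ->
  (forall u, u \in a :: I ++ b :: q -> u \in Y -> u \in I) ->
  exists W, tailsep a b q Y W.
Proof.
move=> mY gs YI; have [cY bY YT NY _] := mY; have [ab aI bI _] := cycle_neq gs.
have [u0 u0Y u0s] := gs.2 Y cY bY.
have /split_first[J1 [c [J2 [EI cYY J1Y]]]] : has (mem Y) I.
  by apply/hasP; exists u0; rewrite ?YI.
(* The vertex before [c] in [I] would be a neighbour of [Y] other than [a] and [b]. *)
have J10 : J1 = [::].
  case/lastP: J1 => // J e in EI J1Y *; exfalso.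
  have eY : e \notin Y.
    by apply: contra J1Y => eY; apply/hasP; exists e; rewrite // mem_rcons mem_head.
  have ec : edge e c.
    apply: (@icyc_edge _ (a :: J) e c (J2 ++ b :: q)).
    by case: gs; rewrite EI cat_rcons -catA.
  have eI : e \in I by rewrite EI mem_cat mem_rcons mem_head.
  have /(subsetP NY)/set2P[ea|eb] : e \in nbh Y.
    by apply: (nbhI cYY _ eY); rewrite edge_sym.
  - by rewrite -ea eI in aI.
  - by rewrite -eb eI in bI.
rewrite J10 /= in EI; rewrite EI in gs YI.
have [X [w [z [hX XY [wX wa] [zX zI]]]]] := @crossing a b Y [::] c J2 q mY gs YI cYY.
have {w wX wa} aX : a \in nbh X by move: wa wX; rewrite inE => /eqP->.
move: zI; rewrite mem_rcons inE => /predU1P[zb|zJ2].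
  by case: (minsep_both_ends mY gs hX XY aX); rewrite -zb.
case/splitPr: zJ2 EI gs YI hX => K1 K2 EI gs YI hX.
by exists (c :: K1, z, K2, X); split.
Qed.

Lemma tailsep_shrink a b q Y (W : seq G * G * seq G * {set G}) :
  minsep a b Y -> tailsep a b q Y W ->
  exists W', tailsep a b q Y W' /\ size W'.1.2 < size W.1.2.
Proof.
case: W => [[[I1 z] I2] H] mY [[gs YI] hH HY aH zH]; rewrite /=.
set I := I1 ++ z :: I2 in gs YI hH *; set s := a :: I ++ b :: q in gs YI hH.
have [ab aI bI qN] := cycle_neq gs.
have zI : z \in I by rewrite mem_cat mem_head orbT.
have IN u : u \in I -> u != a /\ u != b.
  by move=> uI; split; apply: contraTneq uI => ->.
have inY X w : X \subset Y -> w \in nbh X -> w != a -> w != b -> w \in Y.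
  by move=> XY wX wa wb; case: (minsep_nbh mY XY wX) => // E; rewrite E eqxx in wa wb.
have zY : z \in Y by have [? ?] := IN z zI; apply: inY zH _ _.
have U : uniq s by case: gs => -[].
have [X [w [z' [hX XY [wX wI] [z'X z'I]]]]] := crossing mY gs YI zY.
have X2 : 1 < #|nbh X|.
  apply: (card_nbh2 wX z'X); move: U; rewrite /s /I -catA -cat_cons cat_uniq.
  case/and3P=> _ /hasPn H1 _; apply: contraTneq wI => ->; apply: H1.
  by rewrite /= inE -cat_rcons mem_cat z'I orbT.
have Nab X' : hub s X' -> X' \subset Y -> a \in nbh X' -> b \in nbh X' -> False.
  exact: minsep_both_ends mY gs.
(* An attachment [v] of [H] beyond [z] can replace [z] on the same cycle, which shortens the
   tail. *)
case: (boolP (has (mem (nbh H)) (rcons I2 b))) => [/hasP[v vI vH]|NH].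
  move: vI; rewrite mem_rcons inE => /predU1P[vb|vI2].
    by case: (Nab H hH HY aH); rewrite -vb.
  case/splitPr: vI2 @I @s gs YI hH {U hX Nab z'I aI bI qN zI IN inY} => K1 K2 I s gs YI hH.
  exists (I1 ++ z :: K1, v, K2, H); split; last by rewrite /= size_cat /=; clear; lia.
  by rewrite /tailsep -[_ ++ v :: K2]catA.
have XH u : u \in X -> u \notin H.
  move=> uX; apply/negP=> uH.
  have [cX _ sX Xs] := hX; have [cH _ sH Hs] := hH.
  have XsH : X \subset H.
    apply: conn_sub => //; first by exists u.
    by move=> v vX; apply/negP=> /Hs /sX; rewrite vX.
  have HsX : H \subset X.
    apply: conn_sub => //; first by exists u.
    by move=> v vX; apply/negP=> /Xs /sH; rewrite vX.
  have EX : X = H by apply/eqP; rewrite eqEsubset XsH.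
  by move/hasP: NH; apply; exists z' => //; rewrite -EX.
have [k [x [g [y [r [t [H' [E xX yX gX [tX gs' hH' [xH' yH'] rH']]]]]]]]] := gap_step gs hX X2.
have smem : s =i x :: g ++ y :: r by move=> u; rewrite -E mem_rot.
have xy : x != y.
  have : uniq (x :: g ++ y :: r) by rewrite -E rot_uniq.
  by case/andP=> + _; rewrite mem_cat inE !negb_or => /and3P[].
have H'2 := card_nbh2 xH' yH' xy.
have notg u : u \in s -> u \notin g -> u \in H' \/ u \in nbh H'.
  move=> + ug; rewrite smem inE mem_cat inE (negbTE ug) /=.
  by case/or3P=> [/eqP->|/eqP->|/rH']; [right|right|left].
have as_ : a \in s by rewrite mem_head.
have bs : b \in s by rewrite inE mem_cat mem_head !orbT.
(* If the gap contains neither [a] nor [b], both are in or attached to [H']. One of [x], [y] is in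
   [Y], since no component inside [Y] attaches to both [a] and [b]; this contradicts minimality. *)
case: (boolP ((a \notin g) && (b \notin g))) => [/andP[ag bg]|abg].
  exfalso; apply: (minsep_hub mY gs' hH' H'2 (notg a as_ ag) (notg b bs bg)).
  case: (minsep_nbh mY XY xX) => [xY|xa|xb]; first by exists x => //; right.
    case: (minsep_nbh mY XY yX) => [yY|ya|yb]; first by exists y => //; right.
      by rewrite xa ya eqxx in xy.
    by case: (Nab X hX XY); rewrite -?xa -?yb.
  case: (minsep_nbh mY XY yX) => [yY|ya|yb]; first by exists y => //; right.
    by case: (Nab X hX XY); rewrite -?ya -?xb.
  by rewrite xb yb eqxx in xy.
have gN g' : {subset g' <= g} -> ~~ has (mem (nbh X)) g'.
  by move=> sg; apply/hasPn=> u /sg /gX.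
have rotE e g1 g2 F : g = g1 ++ e :: g2 -> rot (index e s) s = e :: F ->
    F = g2 ++ y :: r ++ x :: g1.
  move=> Eg EF; have Es : rot (index x s) s = x :: g ++ y :: r by apply: rot_index_eq E.
  have : rot (index e s) s = e :: g2 ++ y :: r ++ x :: g1.
    have xs : x \in s by rewrite smem mem_head.
    have sz : (size g1).+1 <= size s.
      by have := congr1 size Es; rewrite size_rot Eg /= !size_cat /= => ->; clear; lia.
    have : rot (size g1).+1 (rot (index x s) s) = e :: g2 ++ y :: r ++ x :: g1.
      rewrite Es Eg -catA cat_cons -cat_cons (_ : (size g1).+1 = size (x :: g1)) //.
      by rewrite rot_size_cat -cat_cons -catA.
    by rewrite rot_add_mod ?index_size //; apply: rot_index_eq.
  by rewrite EF => -[].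
have rot_b : rot (index b s) s = b :: q ++ a :: I.
  apply: (@rot_index_eq _ _ _ _ (size (a :: I))) => //.
  by rewrite /s -cat_cons rot_size_cat.
have rot_a : rot (index a s) s = a :: I ++ b :: q.
  by apply: (@rot_index_eq _ _ _ _ 0) => //; rewrite rot0.
(* [H] is disjoint from [X], hence from the new cycle, and is attached to [z]; so [H'] absorbs it
   and reaches its other attachment [a]. *)
have zH'_a : z \in r -> a \in H' \/ a \in nbh H'.
  move=> zr; have zH' := rH' z zr.
  have [_ _ sH' Hs'] := hH'; have [cH _ sH _] := hH.
  have Hs'' h : h \in H -> h \notin nbh H'.
    move=> hH''; apply/negP=> /Hs'; rewrite -cat_rcons -cat_cons mem_cat => /orP[hp|].
      suff /sH : h \in s by rewrite hH''.
      by rewrite smem -cat_rcons -cat_cons mem_cat hp.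
    by move=> /tX/XH; rewrite hH''.
  have [_ [h hH'' hz]] := nbhP _ _ zH.
  have hH1 : h \in H'.
    apply: contraTT (Hs'' h hH'') => hn; rewrite negbK.
    by apply: nbhI zH' _ hn; rewrite edge_sym.
  have HH' : H \subset H' by apply: conn_sub => //; exists h.
  have [_ [a' aH' aa]] := nbhP _ _ aH.
  case: (boolP (a \in H')) => aH1; first by left.
  by right; apply: nbhI aa aH1; apply: (subsetP HH').
(* If the gap contains [a] but not [b], then [z] is in [r] and [H'] again sees both [a] and [b],
   against minimality. *)
case: (boolP (b \in g)) => bg; last first.
  rewrite bg andbT negbK in abg; exfalso.
  have [g1 [g2 Eg]] : exists g1 g2, g = g1 ++ a :: g2.
    by case/splitPr: abg => g1 g2; exists g1, g2.
  have aX : a \notin nbh X by apply: gX; rewrite Eg mem_cat mem_head orbT.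
  have {}wI : w \in I1 by move: wI; rewrite inE => /predU1P[wa|//]; rewrite -wa wX in aX.
  have := rotE _ _ _ _ Eg rot_a; rewrite /I -catA cat_cons => EF.
  have [||||r1 [r2 [Er _ _]]] := between (N := mem (nbh X)) EF.
  - by apply/hasP; exists w.
  - by apply/hasP; exists z' => //; rewrite -cat_rcons mem_cat z'I.
  - by apply: gN => u ug; rewrite Eg mem_cat inE ug !orbT.
  - by apply: gN => u ug; rewrite Eg mem_cat ug.
  have zr : z \in r by rewrite Er mem_cat mem_head orbT.
  apply: (minsep_hub mY gs' hH' H'2 (zH'_a zr) (notg b bs bg)).
  by exists z => //; left; apply: rH'.
have [g1 [g2 Eg]] : exists g1 g2, g = g1 ++ b :: g2.
  by case/splitPr: bg => g1 g2; exists g1, g2.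
have bX : b \notin nbh X by apply: gX; rewrite Eg mem_cat mem_head orbT.
have {}z'I : z' \in I2.
  by move: z'I; rewrite mem_rcons inE => /predU1P[zb|//]; rewrite -zb z'X in bX.
have EF := rotE _ _ _ _ Eg rot_b; rewrite /I -cat_cons catA in EF.
have [||||r1 [r2 [Er EI2 EF1]]] := between (N := mem (nbh X)) EF.
- by apply/hasP; exists w => //; rewrite mem_cat wI orbT.
- by apply/hasP; exists z'.
- by apply: gN => u ug; rewrite Eg mem_cat inE ug !orbT.
- by apply: gN => u ug; rewrite Eg mem_cat ug.
have zr : z \in r by rewrite Er mem_cat mem_head orbT.
(* An attachment of [X] other than [a] and [b] is in [Y], hence in the inner arc. So the gap
   contains all of [q], and the new cycle keeps the outer arc. *)
have yq : y \notin q.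
  apply/negP=> /qN[yI ya yb]; have yY := inY X y XY yX ya yb.
  by move: yI; rewrite YI // smem inE mem_cat mem_head !orbT.
have [h [Eg2 Eh]] := cat_avoid EF1 yq.
(* The vertex [y] may be [a] itself, in which case [h] is empty. *)
have [J EJ] : exists J, rcons h y = a :: J.
  by case: h Eh {Eg2} => [|c h] [-> _]; [exists [::] | exists (rcons h y)].
have Es' : x :: g ++ y :: t = (x :: g1 ++ b :: q) ++ (a :: J ++ t).
  have -> : a :: J ++ t = h ++ y :: t by rewrite -cat_cons -EJ cat_rcons.
  by rewrite Eg Eg2 /= -!catA /= -!catA.
have Ec : a :: ((J ++ t) ++ x :: g1) ++ b :: q = (a :: J ++ t) ++ (x :: g1 ++ b :: q).
  by rewrite /= -!catA.
have cs'' : icyc (a :: ((J ++ t) ++ x :: g1) ++ b :: q).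
  by rewrite Ec; apply: icyc_rot; rewrite -Es'; case: gs'.
have smem' : x :: g ++ y :: t =i a :: ((J ++ t) ++ x :: g1) ++ b :: q.
  by move=> u; rewrite Ec Es' mem_cat orbC -mem_cat.
have gs'' := good_perm cs'' smem' gs'; have hH'' := hub_perm smem' hH'.
(* On the new cycle [x] takes the place of [z]; the tail [g1] is a proper suffix of [I2]. *)
exists (J ++ t, x, g1, H'); split; last first.
  by rewrite /= EI2 size_cat /=; clear; lia.
have [_ _ YT NY _] := mY; have [_ _ sH'' _] := hH''.
have bs'' : b \in a :: ((J ++ t) ++ x :: g1) ++ b :: q by rewrite inE mem_cat mem_head !orbT.
split=> //.
- split=> // u; rewrite inE mem_cat [_ \in b :: q]inE => /or4P[/eqP ua|//|/eqP ub|uq] uY.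
  + by move: (YT u uY); rewrite ua !inE eqxx.
  + by move: (YT u uY); rewrite ub !inE eqxx orbT.
  + have [uI _ _] := qN u uq; rewrite (YI u) // in uI.
    by rewrite /s inE mem_cat inE uq !orbT.
- apply: conn_sub; first by case: hH'.
    by exists z => //; apply: rH'.
  move=> u uH'; apply/negP=> /(subsetP NY)/set2P[] ue; rewrite ue in uH'.
    by move: (sH'' a (mem_head _ _)); rewrite uH'.
  by move: (sH'' b bs''); rewrite uH'.
- case: (zH'_a zr) => // aH'.
  by move: (sH'' a (mem_head _ _)); rewrite aH'.
Qed.

Lemma haven_false : False.
Proof.
have [a [I [b [q [Y [gs mY YI]]]]]] := minsep_exists.
have [W [sW Wmin]] :=
  min_exists (fun W : seq G * G * seq G * {set G} => size W.1.2) (tailsep_exists mY gs YI).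
have [W' [sW' ltW']] := tailsep_shrink mY sW.
by have := Wmin W' sW'; rewrite leqNgt ltW'.
Qed.

End Havens.

(** * Heavy sets *)

Section HeavySets.
Variables (R : realType) (G : sgraph) (w : G -> R).
Hypothesis w_ge0 : weighting w.

Lemma weightU (A B : {set G}) : [disjoint A & B] ->
  weight w (A :|: B) = (weight w A + weight w B)%R.
Proof.
by move=> dAB; rewrite /weight -bigU //=; apply: eq_bigl => x; rewrite inE.
Qed.

Lemma weight_le (A B : {set G}) : A \subset B -> (weight w A <= weight w B)%R.
Proof.
move=> AB; rewrite -(setID B A) (setIidPr AB) weightU; last first.
  by rewrite disjoint_sym disjoints_subset setDE subsetIr.
by rewrite lerDl sumr_ge0.
Qed.

Lemma heavy_meet (A B : {set G}) : heavy w A -> heavy w B ->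
  exists2 x, x \in A & x \in B.
Proof.
move=> hA hB; apply: contrapT => no.
have dAB : [disjoint A & B].
  rewrite disjoints_subset; apply/subsetP=> x xA; rewrite inE.
  by apply/negP=> xB; apply: no; exists x.
(* Two disjoint heavy sets would together outweigh the whole graph. *)
have := weight_le (subsetT (A :|: B)); rewrite weightU // leNgt => /negP; apply.
by rewrite [ltLHS](splitr) mulrC ltrD.
Qed.

Lemma heavy_sub (A B : {set G}) : heavy w A -> A \subset B -> heavy w B.
Proof. by move=> hA /weight_le; apply: lt_le_trans. Qed.

Lemma unbalanced_hcomp (S : {set G}) : ~ balanced_separator w S ->
  exists B, hcomp (heavy w) S B.
Proof.
move=> nb; have [C [CS hC]] : exists C, C \in components (delete_vertices S) /\
    heavy w [set sval x | x in C].
  apply: contrapT => no; apply: nb => C CS hC; apply: no; by exists C.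
case/imsetP: CS => x0 _ EC; exists [set sval x | x in C].
pose e := @edge (delete_vertices S).
have memC (x : delete_vertices S) : (x \in C) = connect e x0 x.
  by rewrite EC !inE.
have sub (y : G) : y \notin S -> exists u : delete_vertices S, val u = y.
  by move=> yS; have yS' : y \in ~: S; [rewrite inE | exists (Sub y yS')].
have sym_e : connect_sym e.
  by apply: sym_connect_sym; apply: edge_sym.
split=> //.
- move=> P [_ /imsetP[x xC ->] Px] Pcl _ /imsetP[y yC ->].
  have : connect e x y.
    by move: xC yC; rewrite !memC sym_e => /connect_trans; apply.
  case/connectP=> p; elim: p x xC Px => [|z p IH] x xC Px /=; first by move=> _ ->.
  case/andP=> xz; have zC : z \in C.
    by move: xC; rewrite !memC => /connect_trans; apply; apply: connect1.
  apply: IH => //; apply: Pcl Px => //; by apply: imset_f.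
- by move=> _ /imsetP[x _ ->]; have := valP x; rewrite inE.
- apply/subsetP=> y /nbhP[yC [_ /imsetP[x xC ->] xy]]; apply: contraNT yC => yS.
  have [u uy] := sub y yS; apply/imsetP; exists u => //.
  move: xC; rewrite !memC => /connect_trans; apply; apply: connect1.
  by move: xy; rewrite -uy.
Qed.

End HeavySets.

Theorem theorem3p4 (R : realType) (l : nat) (l_ge3 : 3 <= l) (G : sgraph)
    (G_free : induced_minor_free (wheel l) G)
    (w : G -> R) (w_weighting : weighting w) :
  exists S : {set G},
    balanced_separator w S /\
    ((exists D : {set G}, #|D| <= l /\ S \subset closed_nbhd D) \/
     #|S| <= (l - 1) ^ 2).
Proof.
(* Without a separator of either kind, every set of either kind leaves a heavy component, which is
   what the haven requires. *)
apply: contrapT => no; apply: (@haven_false G l (heavy w)) => //.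
- exact: heavy_meet.
- exact: heavy_sub.
- move=> S lS; apply: unbalanced_hcomp => bS; apply: no.
  by exists S; split=> //; right.
- move=> D lD; apply: unbalanced_hcomp => bD; apply: no.
  by exists (closed_nbhd D); split=> //; left; exists D.
Qed.
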